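(* Let ${\sf FinDiam}_{\sf conn}$ be the following formula about a countable graph $G=(V,E)$: $$\exists r\ \forall\gamma\in{\rm Path}_G\ \exists\delta\in{\rm Path}_G\ \big[\{\gamma_{\rm start},\gamma_{\rm end}\}=\{\delta_{\rm start},\delta_{\rm end}\}\ \wedge\ |\delta|\le r\big].$$ Then ${\sf FinDiam}_{\sf conn}$ is $\forall^\infty\forall\exists$-dicomplete.
   Context: Quantifiers range over $\omega$. $\exists^\infty n\,\varphi(n)$ means $\forall m\exists n\ge m\,\varphi(n)$ and $\forall^\infty n\,\varphi(n)$ means $\exists m\forall n\ge m\,\varphi(n)$. A quantifier-pattern is a finite string $\bar{\mathsf Q}=\mathsf Q_0\dots\mathsf Q_\ell$ over $\{\exists,\forall,\exists^\infty,\forall^\infty\}$. A $\bar{\mathsf Q}$-formula is $\varphi(\bar x)\equiv\mathsf Q_0n_0\dots\mathsf Q_\ell n_\ell\,\theta(n_0,\dots,n_\ell,\bar x)$ with $\theta$ a bounded formula. The instance $\bar x$ is a tuple of natural numbers and/or total computable functions (computable elements of $\omega^\omega$). Spaces such as $\omega\times\omega^\omega$, $(\omega^\omega)^\omega$, $\omega^{\omega\times\omega}$ are identified with $\omega^\omega$ by computable pairing. Witnesses: for $\alpha\in\omega^\omega$, $\alpha\Vdash\varphi(\bar x)$ (''$\alpha$ is a witness for $\varphi(\bar x)$'') is defined by: $\alpha\Vdash\theta(\bar x)$ iff $\alpha=\bar x$ and $\theta(\bar x)$, for bounded $\theta$; $\langle t,\alpha\rangle\Vdash\exists n\varphi(n,\bar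 x)$ iff $\alpha\Vdash\varphi(t,\bar x)$; $\alpha\Vdash\forall n\varphi(n,\bar x)$ iff $\alpha(n)\Vdash\varphi(n,\bar x)$ for all $n$; $\langle t,\alpha\rangle\Vdash\forall^\infty n\varphi(n,\bar x)$ iff $\alpha(n)\Vdash\varphi(n,\bar x)$ for all $n\ge t$; $\alpha\Vdash\exists^\infty n\varphi(n,\bar x)$ iff for all $n$, writing $\alpha(n)=\langle k,\beta\rangle$, $k\ge n$ and $\beta\Vdash\varphi(k,\bar x)$. Reducibility: $\varphi\le_{\sf m}\psi$ if there are computable functions $\eta,r_-,r_+$ (type-two computable functionals, possibly partial but defined wherever required) such that for every instance $\bar x$: $\varphi(\bar x)$ is true iff $\psi(\eta(\bar x))$ is true; $\alpha\Vdash\varphi(\bar x)$ implies $r_-(\alpha,\bar x)\Vdash\psi(\eta(\bar x))$; $\alpha\Vdash\psi(\eta(\bar x))$ implies $r_+(\alpha,\bar x)\Vdash\varphi(\bar x)$ ($\alpha\in\omega^\omega$ arbitrary). The dual $\varphi^{\sf d}$ of $\mathsf Q_0n_0\dots\mathsf Q_\ell n_\ell\,\theta$ is $\mathsf Q_0^{\sf d}n_0\dots\mathsf Q_\ell^{\sf d}n_\ell\,\neg\theta$, where $\exists^{\sf d}=\forall$, $\forall^{\sf d}=\exists$, $(\exists^\infty)^{\sf d}=\forall^\infty$, $(\forall^\infty)^{\sf d}=\exists^\infty$. $\varphi\le_{\sf dm}\psi$ if $\varphi\le_{\sf m}\psi$ and $\varphi^{\sf d}\le_{\sf m}\psi^{\sf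 d}$ via a common $\eta$ (the $r_\pm$ may differ). $\varphi$ is strictly $\bar{\mathsf Q}$-dicomplete if it is a $\bar{\mathsf Q}$-formula and $\psi\le_{\sf dm}\varphi$ for every $\bar{\mathsf Q}$-formula $\psi$; it is $\bar{\mathsf Q}$-dicomplete if it is $\equiv_{\sf dm}$-equivalent to a strictly $\bar{\mathsf Q}$-dicomplete formula (one such is $\mathsf Q_0n_0\dots\mathsf Q_\ell n_\ell.\ x(n_0,\dots,n_\ell)=0$). Structures: a countable binary relation $(X,R)$, $X\subseteq\omega$, $R\subseteq X^2$, is coded by the pair of characteristic functions of $X$ and $R$, and is identified with its code. Graphs are undirected. Instances are (computable) codes of graphs; reductions from the problem need only work on such codes and reductions to it must output such codes. ${\rm Path}_G$ is the set of (codes of) finite paths of $G$; for a path $\gamma$, $\gamma_{\rm start},\gamma_{\rm end}$ are its start and end points and $|\gamma|$ its length (number of edges). Restricted quantifiers mean $\forall\gamma(\gamma\in{\rm Path}_G\to\cdots)$, $\exists\delta(\delta\in{\rm Path}_G\wedge\cdots)$, with these decidable conditions moved into the innermost bounded part. *)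

(* Defs.v *)
From mathcomp Require Import all_boot.
From Stdlib Require Cantor.

Set Implicit Arguments.
Unset Strict Implicit.
Unset Printing Implicit Defensive.

Notation baire := (nat -> nat).

Definition npair (a b : nat) : nat := Cantor.to_nat (a, b).

(* The identifications w * w^w = w^w, (w^w)^w = w^w and w^w * w^w = w^w. *)
Definition bcons (t : nat) (a : baire) : baire :=
  fun n => if n is m.+1 then a m else t.
Definition btail (a : baire) : baire := fun n => a n.+1.
Definition brow (a : baire) (n : nat) : baire := fun m => a (npair n m).
(* Round-robin join of finitely many sequences; the zero sequence on [::]. *)
Definition bjoin (fs : seq baire) : baire :=
  fun k => nth (fun=> 0) fs (k %% size fs) (k %/ size fs).

(* Kleene's partial recursive functions relative to an oracle, in unary form
   (several arguments are passed through npair). *)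
Inductive code : Type :=
| CZero | CSucc | CFst | CSnd | COracle
| CPair of code & code
| CComp of code & code
| CPrec of code & code
| CMu of code.

(* [eval a c n r]: program c with oracle a halts on input n with output r. *)
Fixpoint eval (a : baire) (c : code) (n r : nat) {struct c} : Prop :=
  match c with
  | CZero => r = 0
  | CSucc => r = n.+1
  | CFst => r = (Cantor.of_nat n).1
  | CSnd => r = (Cantor.of_nat n).2
  | COracle => r = a n
  | CPair c1 c2 =>
      exists u v, [/\ eval a c1 n u, eval a c2 n v & r = npair u v]
  | CComp c1 c2 => exists2 m, eval a c2 n m & eval a c1 m r
  | CPrec c0 cS =>
      let: (x, k) := Cantor.of_nat n in
      (fix run (k r : nat) {struct k} : Prop :=
         if k is i.+1
         then exists2 m, run i m & eval a cS (npair x (npair i m)) r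
         else eval a c0 x r) k r
  | CMu c1 =>
      eval a c1 (npair n r) 0 /\
      forall m, m < r -> exists v, eval a c1 (npair n m) v.+1
  end.

(* The partial type-two functional with program c is defined at a, with value b. *)
Definition computes (c : code) (a b : baire) : Prop :=
  forall n, eval a c n (b n).

Definition computable (f : baire) : Prop := exists c, computes c (fun=> 0) f.

(* An instance is a tuple of numbers and a tuple of functions. *)
Definition inst : Type := (seq nat * seq baire)%type.

(* Instances of a fixed arity as single elements of Baire space. *)
Definition icode (x : inst) : baire := foldr bcons (bjoin x.2) x.1.

(* Bounded formulas of arithmetic with function variables.  Number variables
   are de Bruijn indices into the environment, function variables are indices
   into the function part of the instance; unassigned variables are 0. *)
Inductive term : Type :=
| TVar of nat
| TConst of nat
| TAdd of term & term
| TMul of term & term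
| TApp of nat & term.

Inductive bform : Type :=
| BEq of term & term
| BLe of term & term
| BNot of bform
| BAnd of bform & bform
| BOr of bform & bform
| BAll of term & bform
| BEx of term & bform.

Fixpoint teval (fs : seq baire) (e : seq nat) (t : term) : nat :=
  match t with
  | TVar i => nth 0 e i
  | TConst k => k
  | TAdd t1 t2 => teval fs e t1 + teval fs e t2
  | TMul t1 t2 => teval fs e t1 * teval fs e t2
  | TApp j t1 => nth (fun=> 0) fs j (teval fs e t1)
  end.

Fixpoint bsat (fs : seq baire) (e : seq nat) (th : bform) : Prop :=
  match th with
  | BEq t1 t2 => teval fs e t1 = teval fs e t2
  | BLe t1 t2 => teval fs e t1 <= teval fs e t2
  | BNot th1 => ~ bsat fs e th1
  | BAnd th1 th2 => bsat fs e th1 /\ bsat fs e th2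
  | BOr th1 th2 => bsat fs e th1 \/ bsat fs e th2
  | BAll t th1 => forall i, i <= teval fs e t -> bsat fs (i :: e) th1
  | BEx t th1 => exists2 i, i <= teval fs e t & bsat fs (i :: e) th1
  end.

Inductive quant : Type := QEx | QAll | QInf | QAlm.

Definition qdual (q : quant) : quant :=
  match q with QEx => QAll | QAll => QEx | QInf => QAlm | QAlm => QInf end.

(* [fdom] is the set of instances; [fmat ns x] is the matrix at the values
   ns = [:: n_0; ...; n_l] of the quantified variables. *)
Record formula : Type := Formula {
  fdom : inst -> Prop;
  fpat : seq quant;
  fmat : seq nat -> inst -> Prop
}.

Definition fdual (phi : formula) : formula :=
  Formula (fdom phi) (map qdual (fpat phi)) (fun ns x => ~ fmat phi ns x).

Fixpoint truth_rec (th : seq nat -> Prop) (Q : seq quant) (ns : seq nat) : Prop :=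
  match Q with
  | [::] => th ns
  | QEx :: Q' => exists n, truth_rec th Q' (rcons ns n)
  | QAll :: Q' => forall n, truth_rec th Q' (rcons ns n)
  | QInf :: Q' => forall m, exists2 n, m <= n & truth_rec th Q' (rcons ns n)
  | QAlm :: Q' => exists m, forall n, m <= n -> truth_rec th Q' (rcons ns n)
  end.

Definition holds (phi : formula) (x : inst) : Prop :=
  truth_rec (fun ns => fmat phi ns x) (fpat phi) [::].

(* At a leaf the instance of the matrix is the whole tuple (n_0, ..., n_l, x). *)
Fixpoint wit_rec (th : seq nat -> inst -> Prop) (x : inst)
    (Q : seq quant) (ns : seq nat) (a : baire) : Prop :=
  match Q with
  | [::] => a =1 icode (ns ++ x.1, x.2) /\ th ns x
  | QEx :: Q' => wit_rec th x Q' (rcons ns (a 0)) (btail a)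
  | QAll :: Q' => forall n, wit_rec th x Q' (rcons ns n) (brow a n)
  | QInf :: Q' => forall n, let k := brow a n 0 in
      n <= k /\ wit_rec th x Q' (rcons ns k) (btail (brow a n))
  | QAlm :: Q' => forall n, a 0 <= n ->
      wit_rec th x Q' (rcons ns n) (brow (btail a) n)
  end.

Definition witness (a : baire) (phi : formula) (x : inst) : Prop :=
  wit_rec (fmat phi) x (fpat phi) [::] a.

Definition m_reduces_via (eta : inst -> inst) (phi psi : formula) : Prop :=
  [/\ forall x, fdom phi x -> fdom psi (eta x),
      exists c, forall x, fdom phi x -> computes c (icode x) (icode (eta x)),
      forall x, fdom phi x -> (holds phi x <-> holds psi (eta x)),
      exists c, forall x a, fdom phi x -> witness a phi x ->
        exists2 b, computes c (bjoin [:: a; icode x]) b &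
                   witness b psi (eta x)
    & exists c, forall x a, fdom phi x -> witness a psi (eta x) ->
        exists2 b, computes c (bjoin [:: a; icode x]) b &
                   witness b phi x].

Definition dm_reduces (phi psi : formula) : Prop :=
  exists eta, m_reduces_via eta phi psi /\
              m_reduces_via eta (fdual phi) (fdual psi).

Definition dm_equiv (phi psi : formula) : Prop :=
  dm_reduces phi psi /\ dm_reduces psi phi.

Definition full_dom (p q : nat) (x : inst) : Prop :=
  [/\ size x.1 = p, size x.2 = q
    & forall j, j < q -> computable (nth (fun=> 0) x.2 j)].

Definition is_Qformula (Q : seq quant) (phi : formula) : Prop :=
  fpat phi = Q /\
  exists p q (th : bform),
    (forall x, fdom phi x <-> full_dom p q x) /\
    (forall ns x, size ns = size Q -> fdom phi x ->
       (fmat phi ns x <-> bsat x.2 (ns ++ x.1) th)).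

Definition strictly_dicomplete (Q : seq quant) (phi : formula) : Prop :=
  is_Qformula Q phi /\ forall psi, is_Qformula Q psi -> dm_reduces psi phi.

Definition dicomplete (Q : seq quant) (phi : formula) : Prop :=
  exists2 phi0, strictly_dicomplete Q phi0 & dm_equiv phi phi0.

(* A countable graph is coded by the characteristic functions of its vertex set
   and of its (symmetric) edge relation. *)
Definition gvert (x : inst) : baire := nth (fun=> 0) x.2 0.
Definition gedge (x : inst) : baire := nth (fun=> 0) x.2 1.
Definition in_V (x : inst) (u : nat) : bool := gvert x u == 1.
Definition in_E (x : inst) : rel nat := fun u v => gedge x (npair u v) == 1.

Definition graph_dom (x : inst) : Prop :=
  full_dom 0 2 x /\
  [/\ forall u, gvert x u <= 1,
      forall k, gedge x k <= 1,
      forall u v, in_E x u v -> in_V x u && in_V x v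
    & forall u v, in_E x u v = in_E x v u].

(* Numbers code finite sequences through CodeSeq.code; a path is a nonempty
   sequence of pairwise distinct, consecutively adjacent vertices. *)
Definition is_path (x : inst) (g : nat) : bool :=
  if CodeSeq.decode g is v :: p
  then [&& all (in_V x) (v :: p), path (in_E x) v p & uniq (v :: p)]
  else false.
Definition pstart (g : nat) : nat := head 0 (CodeSeq.decode g).
Definition pend (g : nat) : nat := last 0 (CodeSeq.decode g).
Definition plength (g : nat) : nat := (size (CodeSeq.decode g)).-1.

Definition FinDiam_conn : formula :=
  Formula graph_dom [:: QEx; QAll; QEx] (fun ns x =>
    let r := nth 0 ns 0 in let g := nth 0 ns 1 in let d := nth 0 ns 2 in
    is_path x g ->
    [/\ is_path x d,
        [:: pstart g; pend g] =i [:: pstart d; pend d]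
      & plength d <= r]).

(* Main.v *)
Require Import Defs.
From mathcomp Require Import all_boot zify.
From Stdlib Require Cantor.

(* By search, the value of an innermost existential quantifier over a decidable
   matrix is computable once it is known to exist; so a witness of such a formula
   "Alm n All m Ex k" carries only its first number, and a witness of the dual
   formula only the map from N to some n >= N and m.  It then suffices to transform
   these data computably in both directions.  FinDiam is monotone in r, so its
   leading "Ex" may be read as "Alm".  Conversely, x is sent to a graph whose
   component (n, m) is a path of length n together with a hub adjacent to every
   other vertex for each k with x(n, m, k) = 0: the component has diameter at most
   2 if such a k exists, and n otherwise. *)

Set Implicit Arguments.
Unset Strict Implicit.
Unset Printing Implicit Defensive.

(** * Programs relative to an oracle *)

(** The path length is tied to the variable of Alm because failures are tolerated at finitely many
    [n]. Every component of index [(n, m)] has diameter at most max(n, 2), whatever [m] is, so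
    bounded failures cost only a bounded diameter, while failures at arbitrarily large [n] make the
    diameter unbounded. The formula only compares endpoints already joined by a path, so the graph
    may be disconnected and its components do not interact. Failures can be read off in both
    directions: a path without a short replacement shows [(n, m)] in its start vertex, and a failing
    [(n, m)] yields the hub-free path of its component.

    The obstacle is uniformity: one program must serve all instances and all witnesses, and its
    searches may diverge elsewhere. Computability is therefore proved for families over an arbitrary
    index type [E], which is finally taken to be the type of instances paired with valid witnesses;
    on it every search terminates. *)

Definition pfst (n : nat) : nat := (Cantor.of_nat n).1.
Definition psnd (n : nat) : nat := (Cantor.of_nat n).2.

Lemma of_nat_npair a b : Cantor.of_nat (npair a b) = (a, b).
Proof. exact: Cantor.cancel_of_to. Qed.

Lemma pfstK a b : pfst (npair a b) = a.
Proof. by rewrite /pfst of_nat_npair. Qed.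

Lemma psndK a b : psnd (npair a b) = b.
Proof. by rewrite /psnd of_nat_npair. Qed.

Lemma npair_fst_snd n : npair (pfst n) (psnd n) = n.
Proof.
by rewrite /npair /pfst /psnd -surjective_pairing Cantor.cancel_to_of.
Qed.

Lemma npair_double a b : npair a b * 2 = b * 2 + (b + a) * (b + a + 1).
Proof. by rewrite addn1; apply: Cantor.to_nat_spec. Qed.

Opaque npair pfst psnd.

(* Computability, uniform in the environment [e]: the values of the variables
   are packed into the number [v e], so that going under a binder extends
   [E] to [E * nat] and [v] to [ext v]. *)
Definition computed (E : Type) (o : E -> baire) (v f : E -> nat) : Prop :=
  exists c, forall e, eval (o e) c (v e) (f e).

Definition ext (E : Type) (v : E -> nat) (p : E * nat) : nat :=
  npair (v p.1) p.2.

Definition ext_oracle (E : Type) (o : E -> baire) (p : E * nat) : baire := o p.1.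

Definition computed1 (g : nat -> nat) : Prop :=
  forall E (o : E -> baire) (v f : E -> nat),
  computed o v f -> computed o v (fun e => g (f e)).

Definition computed2 (g : nat -> nat -> nat) : Prop :=
  forall E (o : E -> baire) (v f1 f2 : E -> nat),
  computed o v f1 -> computed o v f2 -> computed o v (fun e => g (f1 e) (f2 e)).

Section Closure.
Variables (E : Type) (o : E -> baire) (v : E -> nat).
Implicit Types f g : E -> nat.

Lemma computed_eq g f : g =1 f -> computed o v g -> computed o v f.
Proof. by move=> gf [c cg]; exists c => e; rewrite -gf. Qed.

(** [code] has no identity program; pairing the two projections gives one, because Cantor pairing is
    onto. *)
Lemma computed_in : computed o v v.
Proof.
exists (CPair CFst CSnd) => e /=; exists (pfst (v e)), (psnd (v e)).
by rewrite npair_fst_snd.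
Qed.

Lemma computed_const k : computed o v (fun=> k).
Proof.
elim: k => [|k [c cP]]; first by exists CZero.
by exists (CComp CSucc c) => e /=; exists k.
Qed.

(** Substitution: this is how a program written for an extended environment gets its extra variables
    instantiated by computed values. *)
Lemma computed_comp (E' : Type) (o' : E' -> baire) (v' f' : E' -> nat)
    (h : E -> E') :
  computed o' v' f' -> (forall e, o' (h e) = o e) ->
  computed o v (fun e => v' (h e)) -> computed o v (fun e => f' (h e)).
Proof.
move=> [c cP] oh [d dP]; exists (CComp c d) => e /=.
by exists (v' (h e)) => //; rewrite -oh.
Qed.

Lemma computed_succ f : computed o v f -> computed o v (fun e => (f e).+1).
Proof. by move=> [c cP]; exists (CComp CSucc c) => e /=; exists (f e). Qed.

Lemma computed_pfst f : computed o v f -> computed o v (fun e => pfst (f e)).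
Proof. by move=> [c cP]; exists (CComp CFst c) => e /=; exists (f e). Qed.

Lemma computed_psnd f : computed o v f -> computed o v (fun e => psnd (f e)).
Proof. by move=> [c cP]; exists (CComp CSnd c) => e /=; exists (f e). Qed.

Lemma computed_oracle f : computed o v f -> computed o v (fun e => o e (f e)).
Proof. by move=> [c cP]; exists (CComp COracle c) => e /=; exists (f e). Qed.

Lemma computed_npair f g :
  computed o v f -> computed o v g -> computed o v (fun e => npair (f e) (g e)).
Proof.
move=> [c cP] [d dP]; exists (CPair c d) => e /=.
by exists (f e), (g e).
Qed.

Lemma computed_weak f :
  computed o v f -> computed (ext_oracle o) (ext v) (fun p => f p.1).
Proof.
move=> [c cP]; exists (CComp c CFst) => -[e k]; exists (v e); last exact: cP.
by rewrite /= /ext of_nat_npair.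
Qed.

Lemma computed_var : computed (ext_oracle o) (ext v) (fun p => p.2).
Proof. by exists CSnd => -[e k]; rewrite /= /ext of_nat_npair. Qed.

Lemma computed_rec f (s : E -> nat -> nat -> nat) g :
  computed o v f ->
  computed (ext_oracle (ext_oracle o)) (ext (ext v)) (fun p => s p.1.1 p.1.2 p.2) ->
  computed o v g ->
  computed o v (fun e => nat_rect (fun=> nat) (f e) (s e) (g e)).
Proof.
move=> [c cP] [d dP] [c' c'P]; have [i iP] := computed_in.
(* [CPrec] hands its step program [npair x (npair i m)], whereas [ext (ext v)] nests to the left;
   [sw] reassociates to [npair (npair x i) m]. *)
pose sw := CPair (CPair CFst (CComp CFst CSnd)) (CComp CSnd CSnd).
exists (CComp (CPrec c (CComp d sw)) (CPair i c')) => e.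
exists (npair (v e) (g e)); first by exists (v e), (g e).
rewrite /= of_nat_npair.
elim: (g e) => [|j IH] //=; eexists; first exact: IH.
exists (npair (npair (v e) j) (nat_rect (fun=> nat) (f e) (s e) j)).
  exists (npair (v e) j), (nat_rect (fun=> nat) (f e) (s e) j); split=> //.
    exists (v e), j; split=> //; first by rewrite of_nat_npair.
    exists (npair j (nat_rect (fun=> nat) (f e) (s e) j)).
      by rewrite of_nat_npair.
    by rewrite of_nat_npair.
  exists (npair j (nat_rect (fun=> nat) (f e) (s e) j)).
    by rewrite of_nat_npair.
  by rewrite of_nat_npair.
exact: dP (e, j, _).
Qed.

End Closure.

Section BooleanClosure.
Variables (E : Type) (o : E -> baire) (v : E -> nat).
Implicit Types f g : E -> nat.

Lemma computed_if (b : E -> bool) f g :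
  computed o v (fun e => b e) -> computed o v f -> computed o v g ->
  computed o v (fun e => if b e then f e else g e).
Proof.
move=> cb cf cg; apply: (@computed_eq _ _ _ (fun e =>
  nat_rect (fun=> nat) (g e) (fun _ _ => f e) (b e))).
  by move=> e; case: (b e).
exact: computed_rec cg (computed_weak (computed_weak cf)) cb.
Qed.

Lemma computed_neg (b : E -> bool) :
  computed o v (fun e => b e) -> computed o v (fun e => ~~ b e).
Proof.
move=> cb; apply: (@computed_eq _ _ _ (fun e => if b e then 0 else 1)).
  by move=> e; case: (b e).
by apply: computed_if => //; apply: computed_const.
Qed.

Lemma computed_and (b1 b2 : E -> bool) :
  computed o v (fun e => b1 e) -> computed o v (fun e => b2 e) ->
  computed o v (fun e => b1 e && b2 e).
Proof.
move=> cb cb2; apply: (@computed_eq _ _ _ (fun e => if b1 e then b2 e : nat else 0)).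
  by move=> e; case: (b1 e).
by apply: computed_if => //; apply: computed_const.
Qed.

Lemma computed_or (b1 b2 : E -> bool) :
  computed o v (fun e => b1 e) -> computed o v (fun e => b2 e) ->
  computed o v (fun e => b1 e || b2 e).
Proof.
move=> cb cb2; apply: (@computed_eq _ _ _ (fun e => if b1 e then 1 else b2 e)).
  by move=> e; case: (b1 e).
by apply: computed_if => //; apply: computed_const.
Qed.

Lemma computed_imp (b1 b2 : E -> bool) :
  computed o v (fun e => b1 e) -> computed o v (fun e => b2 e) ->
  computed o v (fun e => b1 e ==> b2 e).
Proof.
move=> cb cb2; apply: (@computed_eq _ _ _ (fun e => if b1 e then b2 e : nat else 1)).
  by move=> e; case: (b1 e).
by apply: computed_if => //; apply: computed_const.
Qed.

(** Success of the search is required only for the elements of [E], so partial functionals are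
    treated by taking for [E] just the inputs on which they must be defined. *)
Lemma computed_mu (P : E -> nat -> bool) f :
  computed (ext_oracle o) (ext v) (fun p => P p.1 p.2) ->
  (forall e, P e (f e)) -> (forall e k, k < f e -> ~~ P e k) ->
  computed o v f.
Proof.
(* [CMu] looks for the value 0 while truth is 1, so the answer is negated, by a recursion with base
   1 and successor value 0. *)
move=> [c cP] Pf Pn; pose neg := CPrec (CComp CSucc CZero) CZero.
have negP a (b : bool) : eval a neg (npair 0 b) (~~ b).
  rewrite /= of_nat_npair.
  by case: b; [exists 1; first exists 0 | exists 0].
exists (CMu (CComp neg (CPair CZero c))) => e; split.
  exists (npair 0 (P e (f e))).
    by exists 0, (P e (f e)); split=> //; apply: (cP (e, f e)).
  by have := negP (o e) (P e (f e)); rewrite {2}Pf.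
move=> k kf; exists 0, (npair 0 (P e k)).
  by exists 0, (P e k); split=> //; apply: (cP (e, k)).
by have := negP (o e) (P e k); rewrite (Pn e k kf).
Qed.

End BooleanClosure.

Lemma computed_all (E : Type) (o : E -> baire) (v f : E -> nat)
    (P : E -> nat -> bool) :
  computed (ext_oracle o) (ext v) (fun p => P p.1 p.2) ->
  computed o v f -> computed o v (fun e => all (P e) (iota 0 (f e))).
Proof.
move=> cP cf; apply: (@computed_eq _ _ _ (fun e =>
  nat_rect (fun=> nat) 1 (fun j m => if P e j then m else 0) (f e))).
  move=> e; elim: (f e) => // k IH; rewrite [LHS]/= IH.
  by rewrite -[k.+1]addn1 iotaD all_cat /= andbT; case: (P e k); case: all.
simple apply computed_rec; [exact: computed_const | | exact: cf].
apply: (@computed_if _ _ _ (fun p => P p.1.1 p.1.2) (fun p => p.2) (fun=> 0)).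
- exact: computed_weak cP.
- simple apply computed_var.
- exact: computed_const.
Qed.

Lemma computed_var1 (E : Type) (o : E -> baire) (v : E -> nat) :
  computed (ext_oracle (ext_oracle o)) (ext (ext v)) (fun p => p.1.2).
Proof. exact: computed_weak (computed_var o v). Qed.

Lemma computed_var2 (E : Type) (o : E -> baire) (v : E -> nat) :
  computed (ext_oracle (ext_oracle (ext_oracle o))) (ext (ext (ext v)))
    (fun p => p.1.1.2).
Proof. exact: computed_weak (computed_var1 o v). Qed.

Lemma computed_weak2 (E : Type) (o : E -> baire) (v f : E -> nat) :
  computed o v f ->
  computed (ext_oracle (ext_oracle o)) (ext (ext v)) (fun p => f p.1.1).
Proof. by move=> cf; apply: computed_weak (computed_weak cf). Qed.

Lemma computed_weak3 (E : Type) (o : E -> baire) (v f : E -> nat) :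
  computed o v f ->
  computed (ext_oracle (ext_oracle (ext_oracle o))) (ext (ext (ext v)))
    (fun p => f p.1.1.1).
Proof. by move=> cf; apply: computed_weak (computed_weak2 cf). Qed.

Ltac compute_step := first
  [ assumption
  | simple apply computed_const
  | simple apply computed_var
  | simple apply computed_var1
  | simple apply computed_var2
  | simple apply computed_succ
  | simple apply computed_pfst
  | simple apply computed_psnd
  | simple apply computed_npair
  | simple apply computed_neg
  | simple apply computed_and
  | simple apply computed_or
  | simple apply computed_imp
  | simple apply computed_if
  | simple apply computed_rec
  | simple apply computed_weak; assumption
  | simple apply computed_weak2; assumption
  | simple apply computed_weak3; assumption ].
Ltac computability := repeat compute_step.

(** * Arithmetic *)

Lemma computed_pred : computed1 predn.
Proof.
move=> E o v f cf.
apply: (@computed_eq _ _ _ (fun e => nat_rect (fun=> nat) 0 (fun j _ => j) (f e))).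
  by move=> e; case: (f e).
computability.
Qed.

Lemma computed_add : computed2 addn.
Proof.
move=> E o v f g cf cg.
apply: (@computed_eq _ _ _ (fun e =>
  nat_rect (fun=> nat) (f e) (fun _ m => m.+1) (g e))).
  by move=> e; elim: (g e) => [|n IH]; rewrite ?addn0 // addnS -IH.
computability.
Qed.

Lemma computed_sub : computed2 subn.
Proof.
move=> E o v f g cf cg.
apply: (@computed_eq _ _ _ (fun e =>
  nat_rect (fun=> nat) (f e) (fun _ m => m.-1) (g e))).
  by move=> e; elim: (g e) => [|n IH]; rewrite ?subn0 // subnS -IH.
computability; apply: computed_pred; computability.
Qed.

Lemma computed_mul : computed2 muln.
Proof.
move=> E o v f g cf cg.
apply: (@computed_eq _ _ _ (fun e =>
  nat_rect (fun=> nat) 0 (fun _ m => f e + m) (g e))).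
  by move=> e; elim: (g e) => [|n IH]; rewrite ?muln0 // mulnS -IH.
computability; apply: computed_add; computability.
Qed.

Lemma computed_exp2 : computed1 (expn 2).
Proof.
move=> E o v f cf.
apply: (@computed_eq _ _ _ (fun e =>
  nat_rect (fun=> nat) 1 (fun _ m => m + m) (f e))).
  by move=> e; elim: (f e) => [|n IH] //; rewrite expnS mul2n -addnn -IH.
computability; apply: computed_add; computability.
Qed.

Lemma computed_eq0 : computed1 (fun n => n == 0).
Proof.
move=> E o v f cf.
apply: (@computed_eq _ _ _ (fun e => nat_rect (fun=> nat) 1 (fun _ _ => 0) (f e))).
  by move=> e; case: (f e).
computability.
Qed.

Lemma computed_leq : computed2 leq.
Proof.
by move=> E o v f g cf cg; apply: computed_eq0; apply: computed_sub.
Qed.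

Lemma computed_eqn : computed2 (fun m n => m == n).
Proof.
move=> E o v f g cf cg.
apply: (@computed_eq _ _ _ (fun e => (f e <= g e) && (g e <= f e))).
  by move=> e; rewrite -eqn_leq.
by computability; apply: computed_leq.
Qed.

Lemma computed_bcons (E : Type) (o : E -> baire) (v f t : E -> nat)
    (a : E -> baire) :
  computed o v t -> computed o v (fun e => a e (f e).-1) -> computed o v f ->
  computed o v (fun e => bcons (t e) (a e) (f e)).
Proof.
move=> ct ca cf.
apply: (@computed_eq _ _ _ (fun e => if f e == 0 then t e else a e (f e).-1)).
  by move=> e; case: (f e).
by computability; apply: computed_eq0.
Qed.

Ltac compute_arith := first
  [ compute_step
  | simple apply computed_pred
  | simple apply computed_add
  | simple apply computed_sub
  | simple apply computed_mul
  | simple apply computed_exp2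
  | simple apply computed_eq0
  | simple apply computed_leq
  | simple apply computed_eqn
  | simple apply computed_bcons ].
Ltac computability ::= repeat compute_arith.

Lemma computed_div d : 0 < d -> computed1 (divn^~ d).
Proof.
move=> d0 E o v f cf.
apply: (@computed_mu _ _ _ (fun e k => f e < k.+1 * d)).
- by computability.
- by move=> e; rewrite -ltn_divLR.
- by move=> e k kf; rewrite -leqNgt -leq_divRL.
Qed.

Lemma computed_mod d : 0 < d -> computed1 (modn^~ d).
Proof.
move=> d0 E o v f cf.
apply: (@computed_eq _ _ _ (fun e => f e - f e %/ d * d)).
  by move=> e; rewrite {1}(divn_eq (f e) d) addKn.
by computability; apply: computed_div.
Qed.

(** * Uniformly computable families of sequences *)

Definition computed_fun (E : Type) (o : E -> baire) (v : E -> nat)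
    (a : E -> baire) : Prop :=
  computed (ext_oracle o) (ext v) (fun p => a p.1 p.2).

Section ComputedFun.
Variables (E : Type) (o : E -> baire) (v : E -> nat).

Lemma computed_app a f :
  computed_fun o v a -> computed o v f -> computed o v (fun e => a e (f e)).
Proof.
move=> ca cf; apply: (computed_comp (h := fun e => (e, f e)) ca) => //.
exact: computed_npair (computed_in o v) cf.
Qed.

Lemma computed_fun_oracle : computed_fun o v o.
Proof. exact: computed_oracle (computed_var _ _). Qed.

Lemma computed_fun_eq a b :
  (forall e, a e =1 b e) -> computed_fun o v a -> computed_fun o v b.
Proof. by move=> ab ca; apply: computed_eq ca => -[e n]; apply: ab. Qed.

Lemma computed_fun_cat (a : E -> baire) (s : E -> seq nat) p :
  (forall i, computed o v (fun e => nth 0 (s e) i)) ->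
  (forall e, size (s e) = p) -> computed_fun o v a ->
  computed_fun o v (fun e => foldr bcons (a e) (s e)).
Proof.
elim: p s => [|p IH] s cs ss ca.
  by apply: computed_fun_eq ca => e; case: (s e) (ss e).
have := IH (fun e => behead (s e)) _ _ ca; rewrite /computed_fun => IH'.
apply: (@computed_eq _ _ _ (fun q => bcons (nth 0 (s q.1) 0)
    (foldr bcons (a q.1) (behead (s q.1))) q.2)).
  by case=> e n /=; case: (s e) (ss e).
apply: computed_bcons; [exact: computed_weak (cs 0) | | exact: computed_var].
apply: (computed_comp (h := fun q : E * nat => (q.1, q.2.-1)) (IH' _ _)) => //.
- by move=> i; apply: computed_eq (cs i.+1) => e; rewrite nth_behead.
- by move=> e; rewrite size_behead ss.
apply: computed_npair; first exact: computed_weak (computed_in _ _).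
by rewrite /=; computability.
Qed.

End ComputedFun.

Lemma computed_fun_weak (E : Type) (o : E -> baire) (v : E -> nat) a :
  computed_fun o v a -> computed_fun (ext_oracle o) (ext v) (fun p => a p.1).
Proof.
move=> ca; apply: (computed_comp (h := fun p => (p.1.1, p.2)) ca) => //.
apply: computed_npair; last exact: computed_var.
exact: computed_weak2 (computed_in _ _).
Qed.

Lemma computed_fun_weak2 (E : Type) (o : E -> baire) (v : E -> nat) a :
  computed_fun o v a ->
  computed_fun (ext_oracle (ext_oracle o)) (ext (ext v)) (fun p => a p.1.1).
Proof. by move=> ca; apply: computed_fun_weak (computed_fun_weak ca). Qed.

(** With the packed environment constantly 0, a program learns about [e] through the oracle alone;
    this is the uniformity that [m_reduces_via] asks for. *)
Lemma computed_funP (E : Type) (o : E -> baire) (a : E -> baire) :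
  computed_fun o (fun=> 0) a <-> exists c, forall e, computes c (o e) (a e).
Proof.
split=> -[c cP].
  have [i iP] := @computed_in (baire * nat) fst snd.
  exists (CComp c (CPair CZero i)) => e n.
  exists (npair 0 n); last exact: (cP (e, n)).
  by exists 0, n; split=> //; apply: (iP (o e, n)).
exists (CComp c CSnd) => -[e n]; exists n; last exact: cP.
by rewrite /= /ext of_nat_npair.
Qed.

(** * Bounded formulas are decidable *)

Fixpoint bsatb (fs : seq baire) (e : seq nat) (th : bform) : bool :=
  match th with
  | BEq t1 t2 => teval fs e t1 == teval fs e t2
  | BLe t1 t2 => teval fs e t1 <= teval fs e t2
  | BNot th1 => ~~ bsatb fs e th1
  | BAnd th1 th2 => bsatb fs e th1 && bsatb fs e th2
  | BOr th1 th2 => bsatb fs e th1 || bsatb fs e th2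
  | BAll t th1 => all (fun i => bsatb fs (i :: e) th1) (iota 0 (teval fs e t).+1)
  | BEx t th1 =>
      ~~ all (fun i => ~~ bsatb fs (i :: e) th1) (iota 0 (teval fs e t).+1)
  end.

Lemma bsatP fs e th : bsatb fs e th <-> bsat fs e th.
Proof.
elim: th e.
- by move=> t1 t2 e; split=> /eqP.
- by [].
- by move=> th IH e /=; rewrite -IH; split=> /negP.
- by move=> th1 IH1 th2 IH2 e /=; rewrite -IH1 -IH2; split=> /andP.
- by move=> th1 IH1 th2 IH2 e /=; rewrite -IH1 -IH2; split=> /orP.
- move=> t th IH e; split=> [/allP sth i it|sth].
    by apply/IH/sth; rewrite mem_iota.
  by apply/allP => i; rewrite mem_iota add0n => it; apply/IH/sth.
- move=> t th IH e; split=> [/allPn[i]|[i it /IH si]].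
    by rewrite mem_iota negbK => it /IH; exists i.
  by apply/allPn; exists i; rewrite ?mem_iota ?negbK.
Qed.

Lemma computed_teval (E : Type) (o : E -> baire) (v : E -> nat)
    (fs : E -> seq baire) (env : E -> seq nat) t :
  (forall j, computed_fun o v (fun e => nth (fun=> 0) (fs e) j)) ->
  (forall i, computed o v (fun e => nth 0 (env e) i)) ->
  computed o v (fun e => teval (fs e) (env e) t).
Proof.
move=> cfs cenv; elim: t => /=.
- exact: cenv.
- by move=> k; apply: computed_const.
- by move=> t1 c1 t2 c2; computability.
- by move=> t1 c1 t2 c2; computability.
- by move=> j t ct; apply: (computed_app (cfs j)).
Qed.

Lemma computed_bsatb (E : Type) (o : E -> baire) (v : E -> nat)
    (fs : E -> seq baire) (env : E -> seq nat) th :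
  (forall j, computed_fun o v (fun e => nth (fun=> 0) (fs e) j)) ->
  (forall i, computed o v (fun e => nth 0 (env e) i)) ->
  computed o v (fun e => bsatb (fs e) (env e) th).
Proof.
elim: th E o v fs env.
- by move=> t1 t2 E o v fs env cf ce /=; computability; apply: computed_teval.
- by move=> t1 t2 E o v fs env cf ce /=; computability; apply: computed_teval.
- by move=> th IH E o v fs env cf ce /=; computability; apply: IH.
- by move=> th1 IH1 th2 IH2 E o v fs env cf ce /=; computability; auto.
- by move=> th1 IH1 th2 IH2 E o v fs env cf ce /=; computability; auto.
- move=> t th IH E o v fs env cf ce.
  apply: (@computed_all _ _ _ (fun e => (teval (fs e) (env e) t).+1)
    (fun e i => bsatb (fs e) (i :: env e) th)); last first.
    by computability; apply: computed_teval.
  apply: (IH _ _ _ (fun p => fs p.1) (fun p => p.2 :: env p.1)).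
    by move=> j; apply: computed_fun_weak (cf j).
  by case=> [|i]; [apply: computed_var | apply: computed_weak (ce i)].
- move=> t th IH E o v fs env cf ce; apply: computed_neg.
  apply: (@computed_all _ _ _ (fun e => (teval (fs e) (env e) t).+1)
    (fun e i => ~~ bsatb (fs e) (i :: env e) th)); last first.
    by computability; apply: computed_teval.
  apply: computed_neg.
  apply: (IH _ _ _ (fun p => fs p.1) (fun p => p.2 :: env p.1)).
    by move=> j; apply: computed_fun_weak (cf j).
  by case=> [|i]; [apply: computed_var | apply: computed_weak (ce i)].
Qed.

(** * Instances *)

Lemma bjoinE (fs : seq baire) j k :
  j < size fs -> bjoin fs (j + size fs * k) = nth (fun=> 0) fs j k.
Proof.
move=> jfs; rewrite /bjoin mulnC addnC modnMDl modn_small //.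
by rewrite divnMDl ?(leq_ltn_trans _ jfs) // divn_small // addn0.
Qed.

(** The index [f e] is known only at run time; since the length [q] is fixed, the selection unfolds
    into [q] nested case distinctions. *)
Lemma computed_nth_baire (E : Type) (o : E -> baire) (v : E -> nat) q
    (s : E -> seq baire) (f g : E -> nat) :
  (forall e, size (s e) = q) ->
  (forall j, j < q -> computed_fun o v (fun e => nth (fun=> 0) (s e) j)) ->
  computed o v f -> computed o v g ->
  computed o v (fun e => nth (fun=> 0) (s e) (f e) (g e)).
Proof.
elim: q s f => [|q IH] s f ss cs cf cg.
  by apply: (computed_eq _ (computed_const o v 0)) => e;
     rewrite nth_default ?ss.
apply: (@computed_eq _ _ _ (fun e => if f e == 0 then nth (fun=> 0) (s e) 0 (g e)
    else nth (fun=> 0) (behead (s e)) (f e).-1 (g e))).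
  by move=> e; case: (f e) => //= n; rewrite nth_behead.
computability; first exact: computed_app (cs 0 _) cg.
apply: IH => //; last exact: computed_pred.
  by move=> e; rewrite size_behead ss.
move=> j jq; apply: computed_fun_eq (cs j.+1 jq) => e n.
by rewrite nth_behead.
Qed.

Lemma computed_fun_bjoin (E : Type) (o : E -> baire) (v : E -> nat) q
    (s : E -> seq baire) :
  0 < q -> (forall e, size (s e) = q) ->
  (forall j, j < q -> computed_fun o v (fun e => nth (fun=> 0) (s e) j)) ->
  computed_fun o v (fun e => bjoin (s e)).
Proof.
move=> q0 ss cs; apply: (@computed_eq _ _ _ (fun p =>
  nth (fun=> 0) (s p.1) (p.2 %% q) (p.2 %/ q))).
  by move=> [e k]; rewrite /bjoin ss.
apply: (computed_nth_baire (q := q)) => //.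
- by move=> j /cs; apply: computed_fun_weak.
- by apply: computed_mod => //; apply: computed_var.
- by apply: computed_div => //; apply: computed_var.
Qed.

Lemma computed_fun_nth_bjoin (E : Type) (o : E -> baire) (v : E -> nat) q
    (s : E -> seq baire) j :
  (forall e, size (s e) = q) -> computed_fun o v (fun e => bjoin (s e)) ->
  computed_fun o v (fun e => nth (fun=> 0) (s e) j).
Proof.
move=> ss cs; have [jq|qj] := ltnP j q; last first.
  apply: computed_fun_eq (computed_const _ _ 0) => e k /=.
  by rewrite nth_default ?ss.
apply: (@computed_eq _ _ _ (fun p => bjoin (s p.1) (j + q * p.2))).
  by move=> [e k]; rewrite -[in q * _](ss e) bjoinE ?ss.
by apply: computed_app (computed_fun_weak cs) _; computability.
Qed.

Lemma icode_cat (s : seq nat) (fs : seq baire) k :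
  icode (s, fs) (size s + k) = bjoin fs k.
Proof. by rewrite /icode /=; elim: s. Qed.

Lemma icode_nth (s : seq nat) (fs : seq baire) i :
  i < size s -> icode (s, fs) i = nth 0 s i.
Proof. by rewrite /icode /=; elim: s i => //= n s IH [|i] //= /IH. Qed.

Section ComputedInstance.
Variables (E : Type) (o : E -> baire) (v : E -> nat) (x : E -> inst).
Variables (p q : nat).
Hypothesis fx : forall e, full_dom p q (x e).

Lemma computed_inst_num i :
  computed_fun o v (fun e => icode (x e)) ->
  computed o v (fun e => nth 0 (x e).1 i).
Proof.
move=> cx; have [ip|pi] := ltnP i p; last first.
  apply: (computed_eq _ (computed_const o v 0)) => e.
  by case: (fx e) => s1 _ _; rewrite nth_default ?s1.
apply: (@computed_eq _ _ _ (fun e => icode (x e) i)).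
  by move=> e; case: (fx e); case: (x e) => s fs /= s1 _ _; rewrite icode_nth ?s1.
by apply: computed_app cx _; computability.
Qed.

Lemma computed_inst_fun j :
  computed_fun o v (fun e => icode (x e)) ->
  computed_fun o v (fun e => nth (fun=> 0) (x e).2 j).
Proof.
move=> cx; apply: (computed_fun_nth_bjoin (q := q)).
  by move=> e; case: (fx e).
apply: (@computed_eq _ _ _ (fun r => icode (x r.1) (p + r.2))).
  by move=> [e k] /=; case: (fx e); case: (x e) => s fs /= <- _ _; rewrite icode_cat.
by apply: computed_app (computed_fun_weak cx) _; computability.
Qed.
End ComputedInstance.

Lemma computable_unit f :
  computable f <-> computed_fun (fun _ : unit => fun=> 0) (fun=> 0) (fun=> f).
Proof.
rewrite computed_funP; split=> -[c cP]; exists c => //; exact: cP tt.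
Qed.

Lemma full_dom_icode p q x :
  full_dom p q x ->
  computed_fun (fun _ : unit => fun=> 0) (fun=> 0) (fun=> icode x).
Proof.
move=> [s1 s2 cx]; apply: (computed_fun_cat (s := fun=> x.1) (p := p)) => //.
  by move=> i; apply: computed_const.
(* [computed_fun_bjoin] needs a positive number of sequences; the empty join is the zero
   sequence. *)
case: q s2 cx => [|q] s2 cx.
  apply: (computed_fun_eq (a := fun _ _ => 0)); last exact: computed_const.
  by move=> _ k; rewrite /bjoin; case: x.2 s2 => //= _; rewrite nth_nil.
by apply: (computed_fun_bjoin (q := q.+1)) => // j jq; apply/computable_unit/cx.
Qed.

(** * Witnesses of formulas with a decidable matrix *)

(* Since the value of the innermost quantifier of a true formula can be found
   by search, a witness of [Alm n All m Ex k] or [Ex n All m Ex k] amounts to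
   the number [t] with [pos_cert t], and one of the dual formula to a function
   taking [N] to [n], [m] with [neg_cert N n m]. *)
Definition decidable_matrix (dom : inst -> Prop)
    (M : inst -> nat -> nat -> nat -> bool) : Prop :=
  forall E (o : E -> baire) (v : E -> nat) (x : E -> inst) (n m k : E -> nat),
  (forall e, dom (x e)) -> computed_fun o v (fun e => icode (x e)) ->
  computed o v n -> computed o v m -> computed o v k ->
  computed o v (fun e => M (x e) (n e) (m e) (k e)).

Definition tame (b : bool) (phi : formula)
    (M : inst -> nat -> nat -> nat -> bool) : Prop :=
  [/\ fpat phi = [:: if b then QAlm else QEx; QAll; QEx],
      forall x n m k, fdom phi x -> (fmat phi [:: n; m; k] x <-> M x n m k),
      decidable_matrix (fdom phi) M
    & exists p q, forall x, fdom phi x -> full_dom p q x].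

Definition pos_cert (b : bool) (M : nat -> nat -> nat -> bool) (t : nat) :=
  forall n m, (if b then t <= n else t == n) -> exists k, M n m k.

Definition neg_cert (b : bool) (M : nat -> nat -> nat -> bool) (N n m : nat) :=
  (if b then N <= n else N == n) /\ forall k, ~~ M n m k.

Definition leaf (x : inst) n m k : baire :=
  bcons n (bcons m (bcons k (icode x))).

Lemma computed_leaf (E : Type) (o : E -> baire) (v : E -> nat) (x : E -> inst)
    (n m k s : E -> nat) :
  computed_fun o v (fun e => icode (x e)) ->
  computed o v n -> computed o v m -> computed o v k -> computed o v s ->
  computed o v (fun e => leaf (x e) (n e) (m e) (k e) (s e)).
Proof.
move=> cx cn cm ck cs; rewrite /leaf; computability.
by apply: (computed_app cx); computability.
Qed.

Section Tame.
Variables (b : bool) (phi : formula) (M : inst -> nat -> nat -> nat -> bool).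
Hypothesis tame_phi : tame b phi M.

Lemma holds_pos x : fdom phi x -> holds phi x <-> exists t, pos_cert b (M x) t.
Proof.
case: tame_phi => pat mat _ _ dx; rewrite /holds pat /pos_cert.
case: b => /=.
  split=> -[t tP]; exists t.
    by move=> n m /tP/(_ m)[k /mat]; exists k; auto.
  by move=> n tn m; have [k Mk] := tP n m tn; exists k; apply/mat.
split=> -[t tP]; exists t.
  by move=> _ m /eqP<-; have [k /mat] := tP m; exists k; auto.
by move=> m; have [k Mk] := tP t m (eqxx t); exists k; apply/mat.
Qed.

Lemma holds_neg x :
  fdom phi x ->
  holds (fdual phi) x <-> forall N, exists n m, neg_cert b (M x) N n m.
Proof.
case: tame_phi => pat mat _ _ dx; rewrite /holds /= pat /neg_cert.
case: b => /=.
  split=> H N; have := H N.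
    case=> n Nn [m mP]; exists n, m; split=> // k; apply/negP => Mk.
    by apply: (mP k); apply/mat.
  case=> n [m [Nn mP]]; exists n => //; exists m => k /mat Mk.
  by move: (mP k); rewrite Mk.
split=> H N; have := H N.
  case=> m mP; exists N, m; split=> // k; apply/negP => Mk.
  by apply: (mP k); apply/mat.
case=> n [m [/eqP-> mP]]; exists m => k /mat Mk.
by move: (mP k); rewrite Mk.
Qed.

Lemma pos_cert_witness x a :
  fdom phi x -> witness a phi x -> pos_cert b (M x) (a 0).
Proof.
case: tame_phi => pat mat _ _ dx; rewrite /witness pat /pos_cert.
case: b => /= aP n m.
  by move=> tn; have [_ /mat] := aP n tn m; eexists; eauto.
by move=> /eqP<-; have [_ /mat] := aP m; eexists; eauto.
Qed.

(** In a witness of the dual, the row [N] starts with [n] and then [m] when the first quantifier is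
    [QInf]; when it is [QAll], [n] is [N] itself and the row starts with [m]. *)
Definition neg_index (a : baire) N := if b then a (npair N 0) else N.
Definition neg_row (a : baire) N := a (npair N (if b then 1 else 0)).

Lemma neg_cert_witness x a N :
  fdom phi x -> witness a (fdual phi) x ->
  neg_cert b (M x) N (neg_index a N) (neg_row a N).
Proof.
case: tame_phi => pat mat _ _ dx.
rewrite /witness /= pat /neg_cert /neg_index /neg_row.
case: b => /= aP; have := aP N.
  case=> Nn aN; split=> // k; apply/negP => /mat-/(_ dx) Mk.
  by case: (aN k) => _; apply.
by move=> aN; split=> // k; apply/negP => /mat-/(_ dx) Mk; case: (aN k) => _; apply.
Qed.

Section BuildWitness.
Variables (E : Type) (o : E -> baire) (v : E -> nat) (x : E -> inst).
Hypothesis dx : forall e, fdom phi (x e).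
Hypothesis cx : computed_fun o v (fun e => icode (x e)).

Lemma build_pos_witness t :
  computed o v t -> (forall e, pos_cert b (M (x e)) (t e)) ->
  exists2 a, computed_fun o v a & forall e, witness (a e) phi (x e).
Proof.
case: tame_phi => pat mat dec _ ct tP.
(* Weakening the matrix to an implication makes the search defining [K] total, also at indices about
   which the certificate says nothing. *)
have kP e n m : exists k, (if b then t e <= n else t e == n) ==> M (x e) n m k.
  have [tn|_] := boolP (if b then t e <= n else t e == n); last by exists 0.
  by have [k Mk] := tP e n m tn; exists k.
pose K e n m := ex_minn (kP e n m).
have cK : computed (ext_oracle (ext_oracle o)) (ext (ext v))
    (fun p => K p.1.1 p.1.2 p.2).
  apply: (@computed_mu _ _ _ (fun p k => (if b then t p.1.1 <= p.1.2
      else t p.1.1 == p.1.2) ==> M (x p.1.1) p.1.2 p.2 k)).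
  - apply: computed_imp; first by case: (b); computability.
    apply: dec => //; [|by computability..].
    exact: computed_fun_weak (computed_fun_weak2 cx).
  - by move=> p; rewrite /K; case: ex_minnP.
  - move=> p k; rewrite /K; case: ex_minnP => k0 _ k0min; rewrite ltnNge.
    by apply: contra => /k0min.
(* [A] is the witness without its first entry [t e]. Its positions are [npair n (npair m s)] for
   Alm, and [npair m s] for Ex, where [n] is [t e]; [s = 0] holds the value of [k], and the leaf
   follows. *)
pose A e p := let n := if b then pfst p else t e in
  let q := if b then psnd p else p in
  bcons (K e n (pfst q)) (leaf (x e) n (pfst q) (K e n (pfst q))) (psnd q).
exists (fun e => bcons (t e) (A e)).
  have cA : computed_fun o v A.
    rewrite /A; set n := fun (e : E) p => if b then pfst p else t e.
    pose q p := if b then psnd p else p.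
    have cn : computed_fun o v n.
      by rewrite /computed_fun /n; case: (b); computability.
    have cq : computed (ext_oracle o) (ext v) (fun p => q p.2).
      by rewrite /q; case: (b); computability.
    have cKA : computed (ext_oracle o) (ext v)
        (fun p => K p.1 (n p.1 p.2) (pfst (q p.2))).
      apply: (computed_comp (h := fun p => (p.1, n p.1 p.2, pfst (q p.2))) cK) => //.
      apply: computed_npair; last by rewrite /=; computability.
      by apply: computed_npair => //; apply: computed_weak (computed_in _ _).
    rewrite /computed_fun -/(q _).
    apply: computed_bcons; [exact: cKA | | by computability].
    apply: computed_leaf; [exact: computed_fun_weak cx | by computability..].
  apply: computed_bcons; first exact: computed_weak.
    by apply: (computed_app (computed_fun_weak cA)); computability.
  exact: computed_var.
move=> e; rewrite /witness pat /A.
have KP n m : (if b then t e <= n else t e == n) -> M (x e) n m (K e n m).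
  by move=> tn; rewrite /K; case: ex_minnP => k; rewrite tn.
case: (b) KP => /= KP; [move=> n tn m | move=> m];
  rewrite /brow /btail /= ?(pfstK, psndK) /=.
  split=> [s|]; first by rewrite !(pfstK, psndK) /= ?(pfstK, psndK).
  exact/mat/KP.
split=> [s|]; first by rewrite !(pfstK, psndK) /= ?(pfstK, psndK).
exact/mat/KP.
Qed.

(** No search occurs here: the dual prefix ends in a universal quantifier, so each [k] has its own
    row, and the only existential data are the given [n] and [m]. *)
Lemma build_neg_witness n m :
  computed_fun o v n -> computed_fun o v m ->
  (forall e N, neg_cert b (M (x e)) N (n e N) (m e N)) ->
  exists2 a, computed_fun o v a & forall e, witness (a e) (fdual phi) (x e).
Proof.
case: tame_phi => pat mat dec _ cn cm nP.
pose L e N q := leaf (x e) (if b then n e N else N) (m e N) (pfst q) (psnd q).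
pose A e p := let N := pfst p in
  if b then bcons (n e N) (bcons (m e N) (L e N)) (psnd p)
  else bcons (m e N) (L e N) (psnd p).
have cL (f g : E * nat -> nat) : computed (ext_oracle o) (ext v) f ->
    computed (ext_oracle o) (ext v) g ->
    computed (ext_oracle o) (ext v) (fun p => L p.1 (f p) (g p)).
  move=> cf cg.
  apply: computed_leaf; [exact: computed_fun_weak cx | | | by computability..].
    by case: (b) => //; apply: computed_app (computed_fun_weak cn) cf.
  by apply: computed_app (computed_fun_weak cm) cf.
exists A.
  rewrite /computed_fun /A; case: (b).
    apply: computed_bcons.
    - by apply: (computed_app (computed_fun_weak cn)); computability.
    - apply: computed_bcons; [|by apply: cL; computability|by computability].
      by apply: (computed_app (computed_fun_weak cm)); computability.
    - by computability.
  apply: computed_bcons; [|by apply: cL; computability|by computability].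
  by apply: (computed_app (computed_fun_weak cm)); computability.
move=> e; rewrite /witness /= pat /A /L.
case: (b) (nP e) => /= nPe N; have [Nn nM] := nPe N;
  rewrite /brow /btail /= ?(pfstK, psndK) /=.
  split=> // k; split=> [s|]; first by rewrite !(pfstK, psndK) /= ?(pfstK, psndK).
  by move=> /mat-/(_ (dx e)) Mk; move: (nM k); rewrite Mk.
move=> k; split=> [s|]; first by rewrite !(pfstK, psndK) /= ?(pfstK, psndK).
by move/eqP: Nn nM => <- nM /mat-/(_ (dx e)) Mk; move: (nM k); rewrite Mk.
Qed.
End BuildWitness.
End Tame.

(** * From certificates to reductions *)

Definition computed3 (g : nat -> nat -> nat -> nat) : Prop :=
  forall E (o : E -> baire) (v f1 f2 f3 : E -> nat),
  computed o v f1 -> computed o v f2 -> computed o v f3 ->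
  computed o v (fun e => g (f1 e) (f2 e) (f3 e)).

(** One direction of a reduction, for a formula and its dual together, stripped of programs on Baire
    space. [T], [S] and [U] do not see the instance; [S N] is the index at which the given dual
    witness is queried in order to answer [N]. *)
Definition cert_transfer (X : Type) (dom : X -> Prop)
    (b1 : bool) (M1 : X -> nat -> nat -> nat -> bool)
    (b2 : bool) (M2 : X -> nat -> nat -> nat -> bool) : Prop :=
  (exists2 T, computed1 T &
     forall x t, dom x -> pos_cert b1 (M1 x) t -> pos_cert b2 (M2 x) (T t)) /\
  (exists S U, [/\ computed1 S, computed3 U &
     forall x N n m, dom x -> neg_cert b1 (M1 x) (S N) n m ->
       neg_cert b2 (M2 x) N (pfst (U N n m)) (psnd (U N n m))]).

Section Transfer.
Variables (b1 b2 : bool) (phi psi : formula).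
Variables (M1 M2 : inst -> nat -> nat -> nat -> bool).
Hypotheses (tame_phi : tame b1 phi M1) (tame_psi : tame b2 psi M2).
Variables (X : Type) (dom : X -> Prop) (f g : X -> inst).
Hypothesis dom_f : forall x, dom x -> fdom phi (f x).
Hypothesis dom_g : forall x, dom x -> fdom psi (g x).
Hypothesis tr : cert_transfer dom b1 (fun x => M1 (f x)) b2 (fun x => M2 (g x)).
Variable i : X -> baire.
Hypothesis ig : forall E (o : E -> baire) (v : E -> nat) (x : E -> X),
  (forall e, dom (x e)) -> computed_fun o v (fun e => i (x e)) ->
  computed_fun o v (fun e => icode (g (x e))).

Let src a x := bjoin [:: a; i x].

Let computed_src (E : Type) (a i' : E -> baire) :
  computed_fun (fun e => bjoin [:: a e; i' e]) (fun=> 0) a /\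
  computed_fun (fun e => bjoin [:: a e; i' e]) (fun=> 0) i'.
Proof.
by split; [apply: (computed_fun_nth_bjoin (q := 2) (s := fun e => [:: a e; i' e]) 0)
  | apply: (computed_fun_nth_bjoin (q := 2) (s := fun e => [:: a e; i' e]) 1)] => //;
  exact: computed_fun_oracle.
Qed.

(** The index type consists of instances with genuine witnesses, so certificates exist throughout
    and one program results. Keeping both [f] and [g] lets the same lemma give the forward map ([f]
    the identity) and the backward one ([g] the identity). *)
Lemma transfer_pos :
  exists c, forall x a, dom x -> witness a phi (f x) ->
    exists2 b, computes c (src a x) b & witness b psi (g x).
Proof.
pose E := {xa : X * baire | dom xa.1 /\ witness xa.2 phi (f xa.1)}.
pose a (e : E) := (sval e).2; pose x (e : E) := (sval e).1.
have dx e : dom (x e) by case: e => /= ? [].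
have wa e : witness (a e) phi (f (x e)) by case: e => /= ? [].
have [ca ci] := computed_src a (fun e => i (x e)).
case: tr => -[T cT TP] _.
have [||||b cb wb] := @build_pos_witness _ _ _ tame_psi E
  (fun e => src (a e) (x e)) (fun=> 0) (fun e => g (x e)) _ _ (fun e => T (a e 0)).
- by move=> e; apply: dom_g.
- exact: ig.
- by apply: cT; apply: (computed_app ca); computability.
- move=> e; apply: TP => //.
  by apply: (pos_cert_witness tame_phi) => //; apply: dom_f.
move/computed_funP: cb => [c cb]; exists c => x' a' dx' wa'.
by exists (b (exist _ (x', a') (conj dx' wa'))); [apply: cb | apply: wb].
Qed.

Lemma transfer_neg :
  exists c, forall x a, dom x -> witness a (fdual phi) (f x) ->
    exists2 b, computes c (src a x) b & witness b (fdual psi) (g x).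
Proof.
pose E := {xa : X * baire | dom xa.1 /\ witness xa.2 (fdual phi) (f xa.1)}.
pose a (e : E) := (sval e).2; pose x (e : E) := (sval e).1.
have dx e : dom (x e) by case: e => /= ? [].
have wa e : witness (a e) (fdual phi) (f (x e)) by case: e => /= ? [].
have [ca ci] := computed_src a (fun e => i (x e)).
case: tr => _ [S [U [cS cU SU]]].
pose V e N := U N (neg_index b1 (a e) (S N)) (neg_row b1 (a e) (S N)).
have cV : computed_fun (fun e => src (a e) (x e)) (fun=> 0) V.
  have cN : computed (ext_oracle (fun e => src (a e) (x e))) (ext (fun=> 0))
      (fun p => S p.2) by apply: cS; computability.
  apply: cU; first exact: computed_var; rewrite /neg_index /neg_row.
    by case: (b1) => //; apply: (computed_app (computed_fun_weak ca)); computability.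
  by apply: (computed_app (computed_fun_weak ca)); computability.
have [|||||b cb wb] := @build_neg_witness _ _ _ tame_psi E
  (fun e => src (a e) (x e)) (fun=> 0) (fun e => g (x e)) _ _
  (fun e N => pfst (V e N)) (fun e N => psnd (V e N)).
- by move=> e; apply: dom_g.
- exact: ig.
- exact: computed_pfst cV.
- exact: computed_psnd cV.
- move=> e N; apply: SU => //.
  by apply: (neg_cert_witness tame_phi) => //; apply: dom_f.
move/computed_funP: cb => [c cb]; exists c => x' a' dx' wa'.
by exists (b (exist _ (x', a') (conj dx' wa'))); [apply: cb | apply: wb].
Qed.

Lemma transfer_holds x : dom x -> holds phi (f x) -> holds psi (g x).
Proof.
move=> dx /(holds_pos tame_phi (dom_f dx))[t tP].
apply/(holds_pos tame_psi (dom_g dx)).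
by case: tr => -[T _ TP] _; exists (T t); apply: TP.
Qed.

Lemma transfer_holds_dual x :
  dom x -> holds (fdual phi) (f x) -> holds (fdual psi) (g x).
Proof.
move=> dx /(holds_neg tame_phi (dom_f dx)) H.
apply/(holds_neg tame_psi (dom_g dx)) => N.
case: tr => _ [S [U [_ _ SU]]]; have [n [m nm]] := H (S N).
by exists (pfst (U N n m)), (psnd (U N n m)); apply: SU.
Qed.
End Transfer.

(** The equivalence for the duals is transferred separately rather than obtained by negating the
    first one, which avoids classical logic. *)
Lemma dm_reduces_of_certs b1 b2 phi psi M1 M2 (eta : inst -> inst) :
  tame b1 phi M1 -> tame b2 psi M2 ->
  (forall x, fdom phi x -> fdom psi (eta x)) ->
  (forall E (o : E -> baire) (v : E -> nat) (x : E -> inst),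
    (forall e, fdom phi (x e)) -> computed_fun o v (fun e => icode (x e)) ->
    computed_fun o v (fun e => icode (eta (x e)))) ->
  cert_transfer (fdom phi) b1 M1 b2 (fun x => M2 (eta x)) ->
  cert_transfer (fdom phi) b2 (fun x => M2 (eta x)) b1 M1 ->
  dm_reduces phi psi.
Proof.
move=> t1 t2 de ce fwd bwd; exists eta.
have eta_code : exists c, forall x, fdom phi x ->
    computes c (icode x) (icode (eta x)).
  pose E := {x | fdom phi x}.
  have [|c cP] := (computed_funP (fun e : E => icode (sval e)) _).1
    (ce E _ (fun=> 0) (fun e => sval e) (fun e => svalP e) _).
    exact: computed_fun_oracle.
  by exists c => x dx; apply: (cP (exist _ x dx)).
split; split=> //.
- move=> x dx; split.
    exact: (transfer_holds (f := id) t1 t2 (fun _ h => h) de fwd).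
  exact: (transfer_holds t2 t1 de (fun _ h => h) bwd).
- exact: (transfer_pos (f := id) t1 t2 (fun _ h => h) de fwd).
- exact: (transfer_pos (g := id) t2 t1 de (fun _ h => h) bwd).
- move=> x dx; split.
    exact: (transfer_holds_dual (f := id) t1 t2 (fun _ h => h) de fwd).
  exact: (transfer_holds_dual t2 t1 de (fun _ h => h) bwd).
- exact: (transfer_neg (f := id) t1 t2 (fun _ h => h) de fwd).
- exact: (transfer_neg (g := id) t2 t1 de (fun _ h => h) bwd).
Qed.

(** * The canonical complete formula *)

Definition num_fun (h : baire) : inst := ([::], [:: h]).

(* The formula "for almost all n, for all m, there is k with x(n, m, k) = 0",
   Cantor's pairing being expressed through [2 * npair a b = 2b + (a+b)(a+b+1)]. *)
Definition twice_pair (a b : term) : term :=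
  let s := TAdd b a in
  TAdd (TMul b (TConst 2)) (TMul s (TAdd s (TConst 1))).
(** The two bounded quantifiers name [npair m k] and [npair n (npair m k)]. Only the doubled pairing
    is a term, so it serves both as the bound and, in the equation, to pin the value. *)
Definition zero_matrix : bform :=
  let TV := TVar in
  BEx (twice_pair (TV 1) (TV 2))
    (BAnd (BEq (TMul (TV 0) (TConst 2)) (twice_pair (TV 2) (TV 3)))
      (BEx (twice_pair (TV 1) (TV 0))
        (BAnd (BEq (TMul (TV 0) (TConst 2)) (twice_pair (TV 2) (TV 1)))
          (BEq (TApp 0 (TV 0)) (TConst 0))))).

Definition zero_formula : formula :=
  Formula (full_dom 0 1) [:: QAlm; QAll; QEx]
    (fun ns x => bsat x.2 (ns ++ x.1) zero_matrix).

Definition zero_at (x : inst) n m k : bool :=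
  nth (fun=> 0) x.2 0 (npair n (npair m k)) == 0.

Lemma zero_matrixP x n m k :
  bsat x.2 ([:: n; m; k] ++ x.1) zero_matrix <-> zero_at x n m k.
Proof.
rewrite /zero_matrix /zero_at /twice_pair /=; split.
  case=> p _ [pE [q _ [qE xq]]]; apply/eqP; rewrite -[RHS]xq; congr (nth _ _ _ _).
  have -> : npair m k = p by have := npair_double m k; lia.
  by have := npair_double n p; lia.
move=> /eqP x0; exists (npair m k); first by have := npair_double m k; lia.
split; first by rewrite npair_double.
exists (npair n (npair m k)); first by have := npair_double n (npair m k); lia.
by split; first by rewrite npair_double.
Qed.

Lemma tame_zero : tame true zero_formula zero_at.
Proof.
split=> //; last by exists 0, 1.
  by move=> x n m k _; apply: zero_matrixP.
move=> E o v x n m k dx cx cn cm ck; apply: computed_eq0.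
by apply: (computed_app (computed_inst_fun dx 0 cx)); computability.
Qed.

Lemma tame_Qformula psi :
  is_Qformula [:: QAlm; QAll; QEx] psi -> exists M, tame true psi M.
Proof.
case=> pat [p [q [th [dom mat]]]].
exists (fun x n m k => bsatb x.2 ([:: n; m; k] ++ x.1) th); split=> //.
- by move=> x n m k dx; rewrite bsatP mat.
- move=> E o v x n m k dx cx cn cm ck.
  have fx e : full_dom p q (x e) by apply/dom.
  apply: (computed_bsatb (env := fun e => [:: n e; m e; k e] ++ (x e).1)).
    by move=> j; apply: computed_inst_fun fx j cx.
  by case=> [|[|[|i]]] //=; apply: computed_inst_num fx i cx.
- by exists p, q => x /dom.
Qed.

(** The negation is there because [zero_at] reads the value 0 as truth. *)
Definition decision_inst (M : inst -> nat -> nat -> nat -> bool) (x : inst) :=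
  num_fun (fun p => ~~ M x (pfst p) (pfst (psnd p)) (psnd (psnd p))).

Lemma icode_num_fun h : icode (num_fun h) =1 h.
Proof. by move=> k; rewrite /icode /= /bjoin /= modn1 divn1. Qed.

(* A formula with a leading [Ex r] that is monotone in [r] may be read with
   [Alm r] instead. *)
Lemma tame_reduces_zero b phi M :
  tame b phi M ->
  (forall x n n' m k, fdom phi x -> ~~ b -> n <= n' -> M x n m k -> M x n' m k) ->
  dm_reduces phi zero_formula.
Proof.
move=> tphi mono; have [_ _ dec [p [q fx]]] := tphi.
have cM E (o : E -> baire) v x : (forall e, fdom phi (x e)) ->
    computed_fun o v (fun e => icode (x e)) ->
    computed_fun o v (fun e => icode (decision_inst M (x e))).
  move=> dx cx; apply: computed_fun_eq.
    by move=> e k; rewrite icode_num_fun; reflexivity.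
  apply: computed_neg; apply: (dec _ _ _ (fun p => x p.1)) => //;
    [exact: computed_fun_weak cx | by computability..].
have ME x n m k : zero_at (decision_inst M x) n m k = M x n m k.
  by rewrite /zero_at /= !(pfstK, psndK) eqb0 negbK.
apply: (dm_reduces_of_certs (eta := decision_inst M) tphi tame_zero) => //.
- move=> x dx; split=> // -[] // _; apply/computable_unit.
  apply: computed_fun_eq (cM unit _ _ (fun=> x) _ (full_dom_icode (fx x dx))) => //.
  by move=> _ k; rewrite icode_num_fun.
- split.
    exists id => // x t dx tP n m tn.
    (* For Ex the certificate speaks of the index [t] alone; monotonicity carries the [k] found
       there to every [n] above [t]. *)
    have [k Mk] : exists k, M x (if b then n else t) m k.
      by apply: tP; case: (b).
    exists k; rewrite ME; case: (boolP b) Mk => // bF; exact: mono.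
  exists id, (fun N n m => npair n m); split=> //.
    by move=> *; computability.
  move=> x N n m dx [Nn nM]; rewrite pfstK psndK; split=> [|k]; last by rewrite ME.
  by case: (b) Nn => // /eqP->.
- split.
    exists id => // x t dx tP n m tn; have [|k] := tP n m.
      by case: (b) tn => // /eqP->.
    by rewrite ME; exists k.
  exists id, (fun N n m => npair (if b then n else N) m); split=> //.
    by move=> *; case: (b); computability.
  move=> x N n m dx [Nn nM]; rewrite pfstK psndK; split=> [|k]; first by case: (b).
  (* For Ex the failure is needed at [N] itself: a [k] that worked at [N] would also work at the
     larger [n]. *)
  have := nM k; rewrite ME; case: (boolP b) => // bF; apply: contra.
  exact: mono.
Qed.

Lemma zero_strictly_dicomplete :
  strictly_dicomplete [:: QAlm; QAll; QEx] zero_formula.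
Proof.
split=> [|psi /tame_Qformula[M tM]]; last exact: (tame_reduces_zero tM).
by split=> //; exists 0, 1, zero_matrix.
Qed.

(** * Finite sequences and paths *)

Definition chead (g : nat) : nat := head 0 (CodeSeq.decode g).
Definition cbehead (g : nat) : nat := CodeSeq.code (behead (CodeSeq.decode g)).

Lemma exp2_odd_inj v w v' w' :
  2 ^ v * w.*2.+1 = 2 ^ v' * w'.*2.+1 -> v = v' /\ w = w'.
Proof.
elim: v v' => [|v IH] [|v']; rewrite ?expnS ?expn0 ?mul1n -?mulnA.
- by lia.
- by move: (2 ^ v' * _) => z; lia.
- by move: (2 ^ v * _) => z; lia.
- by move=> /eqP; rewrite eqn_pmul2l // => /eqP/IH[-> ->].
Qed.

(** [CodeSeq] codes [v :: s] as 2^v (2c + 1) with c the code of [s], a unique decomposition that a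
    search can find. The code 0 is the empty sequence, whose head and tail default to 0. *)
Lemma computed_uncons : computed1 (fun g => npair (chead g) (cbehead g)).
Proof.
move=> E o v f cf; pose P g z := if g == 0 then z == npair 0 0
  else g == 2 ^ pfst z * (psnd z + psnd z).+1.
have PE g z : P g z = (z == npair (chead g) (cbehead g)).
  rewrite /P; case: eqP => [->|/eqP g0] //; rewrite addnn /chead /cbehead.
  case gE: (CodeSeq.decode g) (CodeSeq.decodeK g) => [|u s] /= <-.
    by rewrite -[g]CodeSeq.decodeK gE in g0.
  apply/eqP/eqP => [/exp2_odd_inj[-> ->]|->]; first by rewrite npair_fst_snd.
  by rewrite pfstK psndK.
apply: (@computed_mu _ _ _ (fun e z => P (f e) z)).
- rewrite /P; apply: (@computed_eq _ _ _ (fun p => if f p.1 == 0 then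
    (p.2 == npair 0 0 : nat) else
    f p.1 == 2 ^ pfst p.2 * (psnd p.2 + psnd p.2).+1)).
    by move=> p; case: ifP.
  by computability.
- by move=> e; rewrite PE.
- by move=> e k; rewrite PE ltn_neqAle => /andP[].
Qed.

Lemma computed_chead : computed1 chead.
Proof.
move=> E o v f cf; have := computed_pfst (computed_uncons cf).
by apply: computed_eq => e; rewrite pfstK.
Qed.

Lemma computed_cbehead : computed1 cbehead.
Proof.
move=> E o v f cf; have := computed_psnd (computed_uncons cf).
by apply: computed_eq => e; rewrite psndK.
Qed.

Lemma iter_cbehead k g :
  iter k cbehead g = CodeSeq.code (drop k (CodeSeq.decode g)).
Proof.
elim: k => [|k IH] /=; first by rewrite drop0 CodeSeq.decodeK.
by rewrite IH /cbehead CodeSeq.codeK -drop1 drop_drop.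
Qed.

Lemma computed_drop :
  computed2 (fun k g => CodeSeq.code (drop k (CodeSeq.decode g))).
Proof.
move=> E o v f g cf cg.
apply: (@computed_eq _ _ _ (fun e =>
  nat_rect (fun=> nat) (g e) (fun _ h => cbehead h) (f e))).
  move=> e; rewrite -iter_cbehead; elim: (f e) => //= k ->.
by computability; apply: computed_cbehead; computability.
Qed.

Definition cnth (k g : nat) : nat := nth 0 (CodeSeq.decode g) k.
Definition csize (g : nat) : nat := size (CodeSeq.decode g).

Lemma computed_cnth : computed2 cnth.
Proof.
move=> E o v f g cf cg; have := computed_chead (computed_drop cf cg).
by apply: computed_eq => e; rewrite /chead CodeSeq.codeK -nth0 nth_drop addn0.
Qed.

Lemma computed_csize : computed1 csize.
Proof.
have c0 s : (CodeSeq.code s == 0) = (s == [::]).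
  by case: s => //= n s; rewrite muln_eq0 expn_eq0.
move=> E o v g cg; apply: (@computed_mu _ _ _ (fun e k =>
  CodeSeq.code (drop k (CodeSeq.decode (g e))) == 0)).
- by computability; apply: computed_drop; computability.
- by move=> e; rewrite drop_size.
- by move=> e k ks; rewrite c0 -size_eq0 size_drop subn_eq0 -ltnNge.
Qed.

(** Quantifiers bounded by positions in the sequence are what [computed_all] can handle;
    distinctness turns into a comparison of all entries at [j < i]. *)
Lemma is_pathE x g :
  is_path x g = [&& 0 < csize g,
    all (fun i => in_V x (cnth i g)) (iota 0 (csize g)),
    all (fun i => in_E x (cnth i g) (cnth i.+1 g)) (iota 0 (csize g).-1) &
    all (fun i => all (fun j => cnth j g != cnth i g) (iota 0 i))
      (iota 0 (csize g))].
Proof.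
rewrite /is_path /csize /cnth; case: (CodeSeq.decode g) => [|u p] //.
rewrite [0 < _]/= andTb; congr [&& _, _ & _].
- apply/(all_nthP 0)/allP => H i; first by rewrite mem_iota => /H.
  by move=> ip; apply: H; rewrite mem_iota.
- apply/(pathP 0)/allP => H i; first by rewrite mem_iota => /H.
  by move=> ip; apply: (H i); rewrite mem_iota.
- apply/idP/allP => [up i|H].
    rewrite mem_iota => /andP[_ ip]; apply/allP => j.
    rewrite mem_iota => /andP[_ ji].
    by rewrite nth_uniq ?(ltn_trans ji) // neq_ltn ji.
  rewrite -[uniq _]negbK; apply/negP => /(uniqPn 0)[j [i [ji ip ji_eq]]].
  have := H i; rewrite mem_iota => /(_ ip)/allP/(_ j); rewrite mem_iota => /(_ ji).
  by rewrite ji_eq eqxx.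
Qed.

Definition findiam_matrix (x : inst) r g d : bool :=
  is_path x g ==> [&& is_path x d,
    ((pstart g == pstart d) && (pend g == pend d)) ||
    ((pstart g == pend d) && (pend g == pstart d)) & plength d <= r].

Lemma eq_mem_pair (T : eqType) (a b c d : T) :
  [:: a; b] =i [:: c; d] <-> (a == c) && (b == d) || (a == d) && (b == c).
Proof.
split=> [H|].
  have := H a; have := H b; have := H c; have := H d.
  rewrite !inE !eqxx ?orbT /= [c == a]eq_sym [d == a]eq_sym [c == b]eq_sym.
  rewrite [d == b]eq_sym.
  by case: (a == c); case: (a == d); case: (b == c); case: (b == d).
by case/orP => /andP[/eqP-> /eqP->] z; rewrite !inE // orbC.
Qed.

Lemma computed_is_path (E : Type) (o : E -> baire) (v : E -> nat) (x : E -> inst)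
    (g : E -> nat) :
  (forall e, graph_dom (x e)) -> computed_fun o v (fun e => icode (x e)) ->
  computed o v g -> computed o v (fun e => is_path (x e) (g e)).
Proof.
move=> dx cx cg.
have fx e : full_dom 0 2 (x e) by case: (dx e).
have cV := computed_inst_fun fx 0 cx; have cE := computed_inst_fun fx 1 cx.
have cs := computed_csize cg.
apply: computed_eq => [e|]; first by rewrite is_pathE; reflexivity.
apply: computed_and; first by computability.
apply: computed_and.
  apply: (@computed_all _ _ _ _ (fun e i => in_V (x e) (cnth i (g e)))) => //.
  apply: computed_eqn; last by computability.
  apply: (computed_app (computed_fun_weak cV)).
  by apply: computed_cnth; computability.
apply: computed_and.
  apply: (@computed_all _ _ _ (fun e => (csize (g e)).-1)
    (fun e i => in_E (x e) (cnth i (g e)) (cnth i.+1 (g e)))); last by computability.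
  apply: computed_eqn; last by computability.
  apply: (computed_app (computed_fun_weak cE)).
  by apply: computed_npair; apply: computed_cnth; computability.
apply: (@computed_all _ _ _ _ (fun e i =>
  all (fun j => cnth j (g e) != cnth i (g e)) (iota 0 i))) => //.
apply: (@computed_all _ _ _ (fun p => p.2)
  (fun p j => cnth j (g p.1) != cnth p.2 (g p.1))); last by computability.
by computability; apply: computed_cnth; computability.
Qed.

Lemma computed_pstart : computed1 pstart.
Proof. exact: computed_chead. Qed.

Lemma computed_pend : computed1 pend.
Proof.
move=> E o v g cg; have : computed o v (fun e => cnth (csize (g e)).-1 (g e)).
  by apply: computed_cnth => //; apply: computed_pred; apply: computed_csize.
by apply: computed_eq => e; rewrite /cnth /csize nth_last.
Qed.

Lemma computed_plength : computed1 plength.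
Proof. by move=> E o v g cg; apply: computed_pred; apply: computed_csize. Qed.

Lemma tame_FinDiam : tame false FinDiam_conn findiam_matrix.
Proof.
split=> //; last by exists 0, 2 => x [].
  move=> x r g d _; rewrite /= /findiam_matrix; split.
    move=> H; apply/implyP => /H[-> /eq_mem_pair gd ->].
    by rewrite andbT.
  by move=> /implyP H /H/and3P[-> gd ->]; split=> //; apply/eq_mem_pair.
move=> E o v x n m k dx cx cn cm ck; rewrite /findiam_matrix.
have cmE := computed_is_path dx cx cm; have ckE := computed_is_path dx cx ck.
have cps := computed_pstart; have cpe := computed_pend.
by computability; auto; apply: computed_plength.
Qed.

Lemma FinDiam_reduces_zero : dm_reduces FinDiam_conn zero_formula.
Proof.
apply: tame_reduces_zero tame_FinDiam _ => x r r' g d _ _ rr' /implyP H.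
apply/implyP => /H/and3P[-> -> dr]; exact: leq_trans rr'.
Qed.

(** * The graph of an instance *)

(* The component of index (n, m) consists of a path with vertices
   [gnode n m s], s <= n, and, for each k with x(n, m, k) = 0, of a hub
   [gnode n m (n + 1 + k)] adjacent to all other vertices. *)
Definition gnode n m s : nat := npair (npair n m) s.
Definition gidx1 u := pfst (pfst u).
Definition gidx2 u := psnd (pfst u).
Definition ghub u : bool := gidx1 u < psnd u.

Definition gvertex (x : inst) u : bool :=
  (psnd u <= gidx1 u) || zero_at x (gidx1 u) (gidx2 u) (psnd u - (gidx1 u).+1).

(** The first component [pfst] is the index of the connected component. Hubs are also adjacent to
    each other, so that no two vertices of a component with a hub are more than 2 apart. *)
Definition gadj u w : bool :=
  [&& pfst u == pfst w, u != w
    & [|| ghub u, ghub w, psnd w == (psnd u).+1 | psnd u == (psnd w).+1]].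

Definition gedges (x : inst) u w : bool := [&& gvertex x u, gvertex x w & gadj u w].

Definition graph_inst (x : inst) : inst :=
  ([::], [:: fun u => gvertex x u : nat;
             fun k => gedges x (pfst k) (psnd k) : nat]).

Lemma in_V_graph x u : in_V (graph_inst x) u = gvertex x u.
Proof. by rewrite /in_V /gvert /= eqb1. Qed.

Lemma in_E_graph x u w : in_E (graph_inst x) u w = gedges x u w.
Proof. by rewrite /in_E /gedge /= eqb1 pfstK psndK. Qed.

Lemma gadj_sym u w : gadj u w = gadj w u.
Proof.
rewrite /gadj [pfst u == _]eq_sym [u == _]eq_sym; congr [&& _, _ & _].
by case: (ghub u); case: (ghub w) => //=; apply: orbC.
Qed.

Lemma computed_graph_inst (E : Type) (o : E -> baire) (v : E -> nat)
    (x : E -> inst) :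
  (forall e, full_dom 0 1 (x e)) -> computed_fun o v (fun e => icode (x e)) ->
  (forall j, j < 2 ->
    computed_fun o v (fun e => nth (fun=> 0) (graph_inst (x e)).2 j)) /\
  computed_fun o v (fun e => icode (graph_inst (x e))).
Proof.
move=> fx cx; have cz := computed_inst_fun fx 0 cx.
have cvert f : computed (ext_oracle o) (ext v) f ->
    computed (ext_oracle o) (ext v) (fun p => gvertex (x p.1) (f p)).
  move=> cf; rewrite /gvertex /gidx1 /gidx2 /zero_at; computability.
  by apply: (computed_app (computed_fun_weak cz)); computability.
have cg j : j < 2 ->
    computed_fun o v (fun e => nth (fun=> 0) (graph_inst (x e)).2 j).
  case: j => [|[|//]] _; first by apply: cvert; computability.
  rewrite /computed_fun /= /gedges /gadj /ghub /gidx1; computability;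
    by apply: cvert; computability.
split=> //; apply: (computed_fun_bjoin (q := 2)) => //.
Qed.

Lemma graph_inst_dom x : full_dom 0 1 x -> graph_dom (graph_inst x).
Proof.
move=> fx; split; [split=> // j j2|split].
- apply/computable_unit.
  by case: (computed_graph_inst (fun=> fx) (full_dom_icode fx)) => /(_ j j2).
- by move=> u; rewrite /gvert /= leq_b1.
- by move=> u; rewrite /gedge /= leq_b1.
- by move=> u w; rewrite in_E_graph !in_V_graph => /and3P[-> ->].
- by move=> u w; rewrite !in_E_graph /gedges gadj_sym andbCA.
Qed.

Section GraphPaths.
Variable x : inst.
Implicit Types (u w : nat) (p : seq nat).

Definition gpath u p :=
  [&& all (gvertex x) (u :: p), path (gedges x) u p & uniq (u :: p)].

Lemma is_path_code u p :
  is_path (graph_inst x) (CodeSeq.code (u :: p)) = gpath u p.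
Proof.
rewrite /is_path CodeSeq.codeK /gpath (eq_all (in_V_graph x)).
by rewrite (eq_path (in_E_graph x)).
Qed.

Lemma is_pathP g : is_path (graph_inst x) g ->
  exists u p, g = CodeSeq.code (u :: p) /\ gpath u p.
Proof.
move=> pg; have := pg; rewrite -[g in is_path _ g]CodeSeq.decodeK.
move: pg; rewrite {1}/is_path; case gE: (CodeSeq.decode g) => [|u p] // _.
by rewrite is_path_code => gp; exists u, p; rewrite -gE CodeSeq.decodeK.
Qed.

Lemma gpath_component u p :
  gpath u p -> {in u :: p, forall w, pfst w = pfst u}.
Proof.
case/and3P=> _ + _; elim: p u => [|w p IH] u /=.
  by move=> _ z; rewrite inE => /eqP->.
case/andP=> /and3P[_ _ /and3P[/eqP uw _ _]] /IH wp z.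
by rewrite inE => /predU1P[->|/wp ->].
Qed.

Lemma hub_zero u :
  gvertex x u -> ghub u -> exists k, zero_at x (gidx1 u) (gidx2 u) k.
Proof.
rewrite /gvertex /ghub ltnNge => /orP[->//|z _].
by exists (psnd u - (gidx1 u).+1).
Qed.

(** A finite path can be scanned for hubs, and a hub itself carries a [k]; thus the case distinction
    is effective although the existence of [k] is only searchable. *)
Lemma hub_or_flat u p : gpath u p ->
  (exists k, zero_at x (gidx1 u) (gidx2 u) k) \/ all (predC ghub) (u :: p).
Proof.
move=> gp; rewrite all_predC.
have [/hasP[w wp hw]|] := boolP (has _ _); last by right.
left; have /andP[/allP/(_ w wp) vw _] := gp.
have := hub_zero vw hw; rewrite /gidx1 /gidx2.
by rewrite (gpath_component gp wp).
Qed.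

(** Pigeonhole: within one component the vertices are told apart by [psnd], which takes at most n +
    1 values off the hubs. *)
Lemma flat_size u p : gpath u p -> all (predC ghub) (u :: p) -> size p <= gidx1 u.
Proof.
move=> gp /allP flat; have /and3P[_ _ up] := gp.
have comp := gpath_component gp.
rewrite -ltnS -[size p < _]/(size (u :: p) <= _) -(size_map psnd).
rewrite -[X in _ <= X](size_iota 0); apply: uniq_leq_size.
  rewrite map_inj_in_uniq // => z t zp tp zt.
  by rewrite -[z]npair_fst_snd -[t]npair_fst_snd zt (comp z) // (comp t).
move=> s /mapP[z zp ->]; rewrite mem_iota /= add0n ltnS.
by have := flat z zp; rewrite /= /ghub -leqNgt /gidx1 (comp z).
Qed.

(** Between non-hubs an edge changes the position [psnd] by exactly one. *)
Lemma flat_distance u p : path (gedges x) u p -> all (predC ghub) (u :: p) ->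
  (psnd u <= psnd (last u p) + size p) && (psnd (last u p) <= psnd u + size p).
Proof.
elim: p u => [|w p IH] u; first by rewrite /= addn0 leqnn.
rewrite [path _ _ _]/= => /andP[/and3P[_ _ /and3P[_ _ st]] wp] /andP[fu fwp].
have /andP[/= /negbTE fw _] := fwp.
move: st (IH w wp fwp); rewrite /= in fu; rewrite (negbTE fu) fw /=.
by move: (psnd (last w p)) (size p) => a b; lia.
Qed.

Lemma gpath_shortcut u p k :
  gpath u p -> zero_at x (gidx1 u) (gidx2 u) k ->
  exists2 q, gpath u q & last u q = last u p /\ size q <= 2.
Proof.
move=> gp zk; set w := last u p.
have wp : w \in u :: p by apply: mem_last.
have /andP[/allP vp _] := gp; have vu := vp u (mem_head _ _); have vw := vp w wp.
have uw : pfst w = pfst u := gpath_component gp wp.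
have [<-|ne_uw] := eqVneq u w.
  by exists [::]; rewrite // /gpath /= vu.
have [uw_adj|uw_nadj] := boolP (gadj u w).
  by exists [:: w]; rewrite // /gpath /= inE vu vw /gedges vu vw uw_adj ne_uw.
pose h := npair (pfst u) ((gidx1 u).+1 + k).
have hh : ghub h by rewrite /ghub /h /gidx1 pfstK psndK ltn_addr.
have vh : gvertex x h.
  by rewrite /gvertex /h /gidx1 /gidx2 pfstK psndK addKn zk orbT.
have hub_adj z : pfst z = pfst u -> ~~ ghub z -> gadj z h && (z != h).
  move=> zu nz; have zh : z != h by apply: contra nz => /eqP->.
  by rewrite /gadj zh hh orbT zu /h pfstK eqxx.
(* Distinct non-adjacent vertices of one component are not hubs, so both differ from [h] and the
   detour [u, h, w] repeats no vertex. *)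
move: uw_nadj; rewrite {1}/gadj uw eqxx ne_uw /= !negb_or => /and3P[hu hw _].
have /andP[uh ne_uh] := hub_adj u erefl hu.
have /andP[wh ne_wh] := hub_adj w uw hw.
exists [:: h; w]; rewrite // /gpath /= !inE vu vw vh /gedges vu vw vh uh gadj_sym wh.
by rewrite negb_or ne_uw ne_uh eq_sym ne_wh.
Qed.

Definition straight n m : nat := CodeSeq.code [seq gnode n m i | i <- iota 0 n.+1].

Lemma straight_path n m : is_path (graph_inst x) (straight n m).
Proof.
rewrite /straight is_path_code /gpath.
rewrite -[gnode n m 0 :: _]/(map (gnode n m) (iota 0 n.+1)).
apply/and3P; split.
- apply/allP => u /mapP[s]; rewrite mem_iota => sn ->.
  by rewrite /gvertex /gnode /gidx1 !pfstK psndK -ltnS; move: sn => /= ->.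
- apply/(pathP 0) => i; rewrite size_map size_iota => ni.
  rewrite -[gnode n m 0 :: _]/(map (gnode n m) (iota 0 n.+1)).
  have ni1 : i < n.+1 := ltnW ni.
  rewrite !(nth_map 0) ?size_iota // !nth_iota //.
  rewrite /gedges /gvertex /gadj /gnode /gidx1 !(pfstK, psndK).
  rewrite add0n add1n !eqxx ni (ltnW ni) /= !orbT andbT.
  by apply/eqP => /(congr1 psnd); rewrite !psndK; lia.
- rewrite map_inj_uniq ?iota_uniq // => i j /(congr1 psnd).
  by rewrite !psndK.
Qed.
End GraphPaths.

Lemma pstart_straight n m : pstart (straight n m) = gnode n m 0.
Proof. by rewrite /pstart CodeSeq.codeK. Qed.

Lemma pend_straight n m : pend (straight n m) = gnode n m n.
Proof.
rewrite /pend CodeSeq.codeK -nth_last size_map size_iota.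
by rewrite (nth_map 0) ?size_iota // nth_iota.
Qed.

Lemma computed_straight : computed2 straight.
Proof.
move=> E o v n m cn cm.
(* A step conses one vertex onto the code [a]; the sequence is built from its last vertex, so step
   [j] adds position [n - j]. *)
pose s e j a := 2 ^ gnode (n e) (m e) (n e - j) * (a + a).+1.
apply: (@computed_eq _ _ _ (fun e => nat_rect (fun=> nat) 0 (s e) (n e).+1)).
  move=> e; suff H j : j <= (n e).+1 -> nat_rect (fun=> nat) 0 (s e) j =
      CodeSeq.code [seq gnode (n e) (m e) i | i <- iota ((n e).+1 - j) j].
    by rewrite H // subnn.
  elim: j => // j IH jn; rewrite [LHS]/= IH ?(ltnW jn) // /s addnn subSS.
  by rewrite [iota _ j.+1]/= -subSn.
by rewrite /s /gnode; computability.
Qed.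

(** Without a hub, [d] must pass from position 0 to position [n], or back, one unit per edge. Both
    orientations occur because endpoints are compared as unordered pairs. *)
Lemma straight_length x n m d :
  is_path (graph_inst x) d ->
  (pstart d == gnode n m 0) && (pend d == gnode n m n) ||
  (pstart d == gnode n m n) && (pend d == gnode n m 0) ->
  (exists k, zero_at x n m k) \/ n <= plength d.
Proof.
case/is_pathP=> u [p [-> gp]]; rewrite /pstart /pend /plength CodeSeq.codeK /=.
move=> ends; have [[k zk]|flat] := hub_or_flat gp.
  left; exists k; move: zk; rewrite /gidx1 /gidx2.
  by case/orP: ends => /andP[/eqP-> _]; rewrite /gnode !(pfstK, psndK).
right; have /and3P[_ pp _] := gp; have := flat_distance pp flat.
case/orP: ends => /andP[/eqP-> /eqP->]; rewrite /gnode !psndK; lia.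
Qed.

Lemma graph_short x g :
  is_path (graph_inst x) g ->
  (exists k, zero_at x (gidx1 (pstart g)) (gidx2 (pstart g)) k) ->
  exists d, findiam_matrix (graph_inst x) 2 g d.
Proof.
case/is_pathP=> u [p [-> gp]] [k]; rewrite /pstart CodeSeq.codeK => zk.
have [q gq [lq sq]] := gpath_shortcut gp zk.
exists (CodeSeq.code (u :: q)).
rewrite /findiam_matrix !is_path_code gp gq implyTb andTb.
by rewrite /pstart /pend /plength !CodeSeq.codeK /= lq !eqxx sq.
Qed.

Lemma graph_long x g :
  is_path (graph_inst x) g ->
  (exists k, zero_at x (gidx1 (pstart g)) (gidx2 (pstart g)) k) \/
  plength g <= gidx1 (pstart g).
Proof.
case/is_pathP=> u [p [-> gp]]; rewrite /pstart /plength CodeSeq.codeK /=.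
by have [|flat] := hub_or_flat gp; [left | right; apply: flat_size gp flat].
Qed.

Lemma findiam_matrix_mono x r r' g d :
  r <= r' -> findiam_matrix x r g d -> findiam_matrix x r' g d.
Proof.
move=> rr' /implyP H; apply/implyP => /H/and3P[-> -> dr].
exact: leq_trans rr'.
Qed.

Lemma findiam_matrix_refl x r g : plength g <= r -> findiam_matrix x r g g.
Proof. by move=> gr; apply/implyP => ->; rewrite !eqxx gr. Qed.

Lemma zero_reduces_FinDiam : dm_reduces zero_formula FinDiam_conn.
Proof.
apply: (dm_reduces_of_certs (eta := graph_inst) tame_zero tame_FinDiam).
- exact: graph_inst_dom.
- by move=> E o v x fx cx; case: (computed_graph_inst fx cx).
- split.
    (* The bound covers both kinds of components: for [n] at least [t] a hub gives length at most 2,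
       and for [n] below [t] a hub-free path has length at most [n]. *)
    exists (fun t => t.+2); first by move=> E o v f cf; computability.
    move=> x t _ tP _ g /eqP<-.
    have [pg|npg] := boolP (is_path (graph_inst x) g); last first.
      by exists 0; rewrite /findiam_matrix (negbTE npg).
    have short := graph_short pg; have [tn|nt] := leqP t (gidx1 (pstart g)).
      have [d gd] := short (tP _ _ tn); exists d; exact: findiam_matrix_mono gd.
    have [/short[d gd]|gn] := graph_long pg.
      by exists d; apply: findiam_matrix_mono gd.
    by exists g; apply: findiam_matrix_refl; lia.
  (* Querying at [r + 1] yields a failing [n > r]; any path between the ends of [straight n m] then
     has length at least [n]. *)
  exists succn, (fun r n m => npair r (straight n m)); split.
  + by move=> E o v f cf; computability.
  + by move=> E o v f1 f2 f3 *; computability; apply: computed_straight.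
  move=> x r n m _ [rn nz]; rewrite pfstK psndK; split=> // d.
  apply/negP; rewrite /findiam_matrix straight_path pstart_straight pend_straight /=.
  case/and3P=> pd ends dr; have [|[k zk]|nd] := @straight_length x n m d pd.
  + by move: ends; rewrite ![gnode _ _ _ == _]eq_sym [in X in _ || X]andbC.
  + by move: (nz k); rewrite zk.
  + by move: dr rn; lia.
- split.
    (* For [n > r], a path of length at most [r] between the ends of the straight path must use a
       hub, whence a [k]. *)
    exists succn; first by move=> E o v f cf; computability.
    move=> x r _ rP n m rn; have [d] := rP r (straight n m) (eqxx r).
    rewrite /findiam_matrix straight_path pstart_straight pend_straight /=.
    case/and3P=> pd ends dr; have [||nd] := @straight_length x n m d pd; last first.
      by move: rn dr nd; lia.
      by [].
    by move: ends; rewrite ![gnode _ _ _ == _]eq_sym [in X in _ || X]andbC.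
  (* A path [g] that is bad for [N + 2] cannot be shortened to length 2, so its component has no
     hub; nor can it replace itself, so its length, hence [n], exceeds [N + 2]. The pair [(n, m)] is
     the component index of its start. *)
  exists (fun N => N.+2), (fun N n g => pfst (pstart g)); split.
  + by move=> E o v f cf; computability.
  + by move=> E o v f1 f2 f3 *; apply: computed_pfst; apply: computed_pstart.
  move=> x N n g _ [/eqP <- ng].
  have pg : is_path (graph_inst x) g.
    by have := ng 0; rewrite /findiam_matrix; case: (is_path _ g).
  have nz k : ~~ zero_at x (gidx1 (pstart g)) (gidx2 (pstart g)) k.
    apply/negP => zk; have [|d gd] := graph_short pg; first by exists k.
    by move: (ng d); rewrite (findiam_matrix_mono _ gd).
  split=> //=; have [[k zk]|gn] := graph_long pg; first by move: (nz k); rewrite zk.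
  rewrite leqNgt; apply/negP => gN; move: (ng g).
  by rewrite findiam_matrix_refl // /gidx1; move: gn; rewrite /gidx1; lia.
Qed.

Theorem theorem3p23 : dicomplete [:: QAlm; QAll; QEx] FinDiam_conn.
Proof.
exists zero_formula; first exact: zero_strictly_dicomplete.
split; [exact: FinDiam_reduces_zero | exact: zero_reduces_FinDiam].
Qed.
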